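(* Let $\mathcal U$ be the set of unimodal bargraphs with a centered maximum, and let $X_n$ be the random variable giving the degree of symmetry of a uniformly random element of $\mathcal U$ with semiperimeter $n$. Then the sequence $X_n$ has a Rayleigh limiting distribution, that is, as $n\to\infty$, $$\frac{X_n}{\sqrt{n}}\stackrel{d}{\to}\mathcal R\left(\frac{3-\sqrt{5}}{2\sqrt[4]{20}}\right).$$
   Context: A composition is a sequence of positive integers $(a_1,\dots,a_k)$ with $k\ge1$. It is represented as a bargraph $B$: $k$ bottom-justified columns of unit boxes, where column $i$ from the left has $a_i$ boxes. A bargraph is identified with the lattice path given by its upper boundary, a self-avoiding path with steps $N=(0,1)$, $E=(1,0)$, $S=(0,-1)$ starting at the origin and returning to the $x$-axis only at the end. $e(B)$ is the number of $E$ steps (so $e(B)=k$), $n(B)$ is the number of $N$ steps of this path, and the semiperimeter is $e(B)+n(B)$. The degree of symmetry of $B$ is the number of indices $1\le i\le k/2$ with $a_i=a_{k+1-i}$. A unimodal bargraph with a centered maximum is one whose column heights satisfy $1\le a_1\le a_2\le\dots\le a_{\lfloor (k+1)/2\rfloor}$ and $a_{\lceil (k+1)/2\rceil}\ge\dots\ge a_{k-1}\ge a_k\ge1$. $\mathcal R(\sigma)$ denotes the Rayleigh distribution with density $\frac{x}{\sigma^2}e^{-x^2/2\sigma^2}$ for $x\ge0$; $\stackrel{d}{\to}$ denotes convergence in distribution. *)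

(* Defs.v *)
From HB Require Import structures.
From mathcomp Require Import all_boot all_order all_algebra.
From mathcomp Require Import all_classical all_reals all_analysis.
From mathcomp Require Import measurable_realfun.
From mathcomp Require Import ring.

Set Implicit Arguments.
Unset Strict Implicit.
Unset Printing Implicit Defensive.

Import Order.TTheory GRing.Theory Num.Theory.
Import numFieldNormedType.Exports.

Local Open Scope classical_set_scope.
Local Open Scope ring_scope.

Record bargraph := Bargraph {
  columns :> seq nat;
  bargraphP : (0 < size columns)%N && all (fun h => (0 < h)%N) columns }.

HB.instance Definition _ := [isSub for columns].
HB.instance Definition _ := [Countable of bargraph by <:].
HB.instance Definition _ := isPointed.Build bargraph (@Bargraph [:: 1%N] erefl).

(* Height of the [i]-th column from the left, columns being numbered from 1. *)
Definition height (B : bargraph) (i : nat) : nat := nth 0%N B i.-1.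

(* The steps (0,1), (1,0) and (0,-1). *)
Inductive step := North | East | South.

Definition is_north s := if s is North then true else false.
Definition is_east s := if s is East then true else false.

(* Upper boundary of the columns [hs], entered at height [y] and left on the
   x-axis; of the two vertical runs before an [East], at most one is nonempty. *)
Fixpoint boundary_from (y : nat) (hs : seq nat) : seq step :=
  if hs is h :: hs' then
    nseq (h - y) North ++ nseq (y - h) South ++ East :: boundary_from h hs'
  else nseq y South.

Definition upper_boundary (B : bargraph) : seq step := boundary_from 0 B.

Definition e_steps (B : bargraph) : nat := count is_east (upper_boundary B).
Definition n_steps (B : bargraph) : nat := count is_north (upper_boundary B).
Definition semiperimeter (B : bargraph) : nat := (e_steps B + n_steps B)%N.

Definition degree_of_symmetry (B : bargraph) : nat :=
  let k := size B in
  count (fun i => height B i == height B (k.+1 - i)) (iota 1 k./2).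

Definition unimodal_centered_max : set bargraph := [set B : bargraph |
  let k := size B in
  (forall i, (1 <= i < (k.+1)./2)%N -> (height B i <= height B i.+1)%N) /\
  (forall i, (uphalf k.+1 <= i < k)%N -> (height B i.+1 <= height B i)%N)].

HB.instance Definition _ := @isMeasurable.Build default_measure_display
  bargraph discrete_measurable discrete_measurable0
  discrete_measurableC discrete_measurableU.

Lemma measurable_bargraph (A : set bargraph) : measurable A.
Proof. by []. Qed.

(* For finite nonempty [A], a set [V] gets mass #(V `&` A) / #A.  Otherwise
   [mnormalize] falls back on its last argument; for the sets
   [unimodal_of_semiperimeter n] below, always finite, this only concerns
   [n < 2], where there is no bargraph. *)
Definition uniform_on (R : realType) (A : set bargraph) : probability bargraph R :=
  mnormalize (mrestr (@counting bargraph R) (measurable_bargraph A))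
             (dirac point).

Definition unimodal_of_semiperimeter (n : nat) : set bargraph :=
  unimodal_centered_max `&` [set B | semiperimeter B = n].

Section degree_of_symmetry_rv.
Variables (R : realType) (n : nat).

Definition degsym_fun (B : bargraph) : R := (degree_of_symmetry B)%:R.

Lemma measurable_degsym_fun : measurable_fun [set: bargraph] degsym_fun.
Proof. by []. Qed.

HB.instance Definition _ :=
  @isMeasurableFun.Build _ _ bargraph R degsym_fun measurable_degsym_fun.

Definition degsym_rv :
  {RV (uniform_on R (unimodal_of_semiperimeter n)) >-> R} := degsym_fun.

End degree_of_symmetry_rv.

Definition cvg_in_distribution d (T : measurableType d) (R : realType)
    (P : nat -> probability T R) (X : forall n, {RV (P n) >-> R})
    (mu : probability R R) : Prop :=
  let F := fun x : R => mu `]-oo, x]%classic in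
  forall x : R, {for x, continuous F} -> cdf (X n) x @[n --> \oo] --> F x.
Arguments cvg_in_distribution {d T R} P X mu.

Section rayleigh.
Variable R : realType.
Implicit Types s x : R.
Local Notation mu := lebesgue_measure.

Let rayleigh_fun s x := x / s ^+ 2 * expR (- x ^+ 2 / (2 * s ^+ 2)).

(* As for [normal_pdf], the degenerate parameter [s = 0] gets a junk density, so
   that [rayleigh_prob s] is a probability for every [s]. *)
Definition rayleigh_pdf s : R -> R :=
  if s == 0 then \1_`[0, 1] else rayleigh_fun s \_ `[0, +oo[.

Lemma rayleigh_pdf_ge0 s x : 0 <= rayleigh_pdf s x.
Proof.
rewrite /rayleigh_pdf; case: ifP => _ //.
apply: restrict_ge0 => {}x /=; rewrite in_itv/= andbT => x0.
by rewrite mulr_ge0 ?expR_ge0// divr_ge0// sqr_ge0.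
Qed.

Let continuous_rayleigh_fun s : continuous (rayleigh_fun s).
Proof.
move=> x; apply: cvgM; first by apply: cvgM; [exact: cvg_id|exact: cvg_cst].
apply: continuous_comp; last exact: continuous_expR.
apply: cvgM; last exact: cvg_cst.
by apply: cvgN; exact: exprn_continuous.
Qed.

Lemma measurable_rayleigh_pdf s : measurable_fun [set: R] (rayleigh_pdf s).
Proof.
rewrite /rayleigh_pdf; case: ifP => _; first exact: measurable_indic.
apply/measurable_restrict => //; apply: measurable_funTS.
exact: continuous_measurable_fun.
Qed.

Definition rayleigh_prob s (V : set R) : \bar R :=
  (\int[mu]_(x in V) (rayleigh_pdf s x)%:E)%E.

Let derive_rayleigh s x : s != 0 ->
  is_derive x 1 (fun y => - expR (- y ^+ 2 / (2 * s ^+ 2))) (rayleigh_fun s x).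
Proof.
move=> s0; rewrite /rayleigh_fun.
have H : is_derive x 1 (fun y : R => - y ^+ 2 / (2 * s ^+ 2)) (- (x / s ^+ 2)).
  apply: is_derive_eq; rewrite scaler0 add0r /GRing.scale/=.
  by field.
apply: is_derive_eq.
by rewrite mulrN opprK mulrC.
Qed.

Let cvg_rayleigh s : s != 0 ->
  - expR (- x ^+ 2 / (2 * s ^+ 2)) @[x --> +oo] --> (0 : R).
Proof.
move=> s0; rewrite -oppr0; apply: cvgN.
rewrite (_ : (fun x => _) =
    (fun z => expR (- z)) \o (fun x => (2 * s ^+ 2)^-1 * x ^+ 2)); last first.
  by apply/funext => x /=; rewrite mulNr mulrC.
apply: (@cvg_comp _ _ _ _ _ _ (pinfty_nbhs R)); last exact: cvgr_expR.
apply: gt0_cvgMry; last first.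
  apply/cvgryPge => A; near=> x.
  have x1 : 1 <= x by near: x; exact: nbhs_pinfty_ge.
  have xA : A <= x by near: x; exact: nbhs_pinfty_ge.
  by rewrite (le_trans xA)// expr2 ler_peMl// (le_trans _ x1).
by rewrite invr_gt0 mulr_gt0// exprn_even_gt0.
Unshelve. all: by end_near. Qed.

Lemma integral_rayleigh_pdf s : (\int[mu]_x (rayleigh_pdf s x)%:E = 1)%E.
Proof.
rewrite /rayleigh_pdf; case: eqP => [_|/eqP s0].
  by rewrite integral_indic//= setIT lebesgue_measure_itv/= lte_fin ltr01 oppr0 adde0.
rewrite -[X in integral _ _ X]/(EFin \o _) -restrict_EFin.
rewrite -integral_mkcond.
rewrite (@ge0_continuous_FTC2y _ _
  (fun x => - expR (- x ^+ 2 / (2 * s ^+ 2))) _ 0).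
- by rewrite expr0n/= oppr0 mul0r expR0 opprK add0e.
- by move=> x x0; rewrite mulr_ge0 ?expR_ge0// divr_ge0// sqr_ge0.
- exact/continuous_subspaceT/continuous_rayleigh_fun.
- exact: cvg_rayleigh.
- by move=> x _; have [] := derive_rayleigh x s0.
- apply: cvg_at_right_filter.
  have [/derivable1_diffP/differentiable_continuous + _] := derive_rayleigh 0 s0.
  exact.
- by move=> x _; rewrite derive1E; have [_ ->] := derive_rayleigh x s0.
Qed.

Let rayleigh0 s : rayleigh_prob s set0 = 0%E.
Proof. exact: integral_set0. Qed.

Let rayleigh_ge0 s A : (0 <= rayleigh_prob s A)%E.
Proof. by apply: integral_ge0 => x _; rewrite lee_fin rayleigh_pdf_ge0. Qed.

Let rayleigh_sigma_additive s : semi_sigma_additive (rayleigh_prob s).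
Proof.
move=> /= F mF tF mUF; rewrite /rayleigh_prob; apply: cvg_toP.
  apply: ereal_nondecreasing_is_cvgn => m n mn.
  apply: lee_sum_nneg_natr => // k _ _; apply: integral_ge0 => /= x Fkx.
  by rewrite lee_fin rayleigh_pdf_ge0.
rewrite ge0_integral_bigcup//=.
- apply/measurable_funTS/measurableT_comp => //.
  exact: measurable_rayleigh_pdf.
- by move=> x _; rewrite lee_fin rayleigh_pdf_ge0.
Qed.

HB.instance Definition _ s := isMeasure.Build _ _ _ (rayleigh_prob s)
  (rayleigh0 s) (@rayleigh_ge0 s) (@rayleigh_sigma_additive s).

HB.instance Definition _ s := Measure_isProbability.Build _ _ R
  (rayleigh_prob s) (integral_rayleigh_pdf s).

End rayleigh.

(* Main.v *)
Require Import Defs.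
From HB Require Import structures.
From mathcomp Require Import all_boot all_order all_algebra finmap.
From mathcomp Require Import all_classical all_reals all_analysis measurable_realfun.
From mathcomp Require Import ring lra zify.

(** Let [rho = (3 - sqrt 5) / 2].  Reading the columns of a unimodal bargraph in
    pairs from the centre outwards turns those of semiperimeter [N + 1] into the
    pairs of weakly decreasing sequences of length [m] with values in [0..N - 2m];
    the degree of symmetry becomes the number of coincidences.  Let [T] be the
    generating function of these pairs by [N].  Cutting at [r] marked coincidences
    shows that the [r]-th binomial moments have generating function
    [z^(2r) T^(r+1)], and [T^2 ((1 - z - z^2)^2 - 4 z^3) = 1], whose dominant
    singularity is [rho].  Hence [T (rho z) = h (z) (1 - z)^(-1/2)] with [h]
    absolutely convergent at [1], so the coefficients of [T^(2q+1)] are equivalent to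
    those of [h(1)^(2q+1) (1 - rho^-1 z)^(-q-1/2)], and the even moments of
    [X_n / sqrt n] converge to [q! (2 sigma^2)^q], the moments of a squared Rayleigh
    variable, which is exponential.

    With [V_n] the rescaled square, Taylor expansion and induction on [i] give the
    limits of [E (V_n^k exp(- i V_n / 2))]; thus the moments of [exp(- V_n)] converge
    to those of the uniform law on [0, 1], and Bernstein polynomials of step functions
    give the limit of its distribution function.  Only even moments are needed, so no
    Gamma function at half-integers occurs. *)

Set Implicit Arguments.
Unset Strict Implicit.
Unset Printing Implicit Defensive.

Import Order.TTheory GRing.Theory Num.Theory.
Import numFieldNormedType.Exports.

Local Open Scope classical_set_scope.
Local Open Scope ring_scope.

(** * Formal power series *)

(** Explicit square roots take the place of complex singularity analysis. The radicand factors as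
    [(1 - 3 z + z^2) (1 + z + z^2)], and the roots of the first factor are [rho] and [rho^-1]. After
    [z = rho X], only the factor [1 - X] vanishes on the closed unit disc; the others have inverse
    square roots built from central binomial coefficients with geometric decay, whence the
    convergence of [h] at 1.

    For [r = 2q] the power of [T] is odd. Dividing by the coefficient of [T] itself therefore leaves
    the integer power [n^q], divided by [(1/2)(3/2)...(q - 1/2)], and [(2q)!] turns this quotient
    into [4^q q!]. What remains is [2 sigma^2 = 4 rho^4 h(1)^2 = rho^2 / sqrt 5]; the fourth root of
    20 comes from [sqrt 20 = 2 sqrt 5].

    The moments [k!] have an exponential generating function of radius exactly 1, so [exp(- V)]
    cannot be expanded in one go: this forces the half steps [exp(- V / 2)]. *)

Definition fps (R : comNzRingType) := nat -> R.

HB.instance Definition _ (R : comNzRingType) :=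
  GRing.Zmodule.copy (fps R) (nat -> R).

Section Fps.
Variable R : comNzRingType.
Implicit Types (a b c : fps R) (n N : nat).

Definition fps_one : fps R := fun n => (n == 0)%:R.
Definition fps_mul a b : fps R := fun n => \sum_(i < n.+1) a i * b (n - i)%N.

Definition fps_trunc N a : {poly R} := \poly_(i < N) a i.

(** The ring laws of series are transported from [{poly R}]: a coefficient of a product depends only
    on truncations of the factors. *)
Lemma coef_fps_truncM N a b n : (n < N)%N ->
  (fps_trunc N a * fps_trunc N b)`_n = fps_mul a b n.
Proof.
move=> nN; rewrite coefM; apply: eq_bigr => i _; rewrite !coef_poly.
by rewrite !(leq_ltn_trans _ nN) ?leq_subr // -ltnS.
Qed.

Fact fps_mulC : commutative fps_mul.
Proof.
move=> a b; apply/funext => n.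
by rewrite -!(@coef_fps_truncM n.+1)// mulrC.
Qed.

Lemma coef_fps_truncM3 N a b c n : (n < N)%N ->
  (fps_trunc N a * fps_trunc N b * fps_trunc N c)`_n =
  fps_mul (fps_mul a b) c n.
Proof.
move=> nN; rewrite coefM; apply: eq_bigr => i _.
have iN : (i < N)%N by rewrite (leq_ltn_trans _ nN)// -ltnS.
rewrite coef_fps_truncM// coef_poly (leq_ltn_trans _ nN)//.
exact: leq_subr.
Qed.

Fact fps_mulA : associative fps_mul.
Proof.
move=> a b c; apply/funext => n.
by rewrite (fps_mulC a) -!(@coef_fps_truncM3 n.+1)// mulrC mulrA.
Qed.

Fact fps_mul1 : left_id fps_one fps_mul.
Proof.
move=> a; apply/funext => n; rewrite /fps_mul big_ord_recl /fps_one/= mul1r subn0.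
by rewrite big1 ?addr0// => i _; rewrite mul0r.
Qed.

Fact fps_mulDl : left_distributive fps_mul +%R.
Proof.
move=> a b c; apply/funext => n; rewrite /fps_mul.
rewrite [RHS](_ : _ = fps_mul a c n + fps_mul b c n)//= -big_split/=.
by apply: eq_bigr => i _; rewrite -mulrDl.
Qed.

Fact fps_one_neq0 : fps_one != 0.
Proof. by apply/eqP => /(congr1 (@^~ 0%N)) /eqP; rewrite oner_eq0. Qed.

HB.instance Definition _ := GRing.Zmodule_isComNzRing.Build (fps R)
  fps_mulA fps_mulC fps_mul1 fps_mulDl fps_one_neq0.

Lemma fpsM a b n : (a * b) n = \sum_(i < n.+1) a i * b (n - i)%N.
Proof. by []. Qed.
Lemma fps1 n : (1 : fps R) n = (n == 0)%:R. Proof. by []. Qed.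
Lemma fps0 n : (0 : fps R) n = 0. Proof. by []. Qed.
Lemma fpsD a b n : (a + b) n = a n + b n. Proof. by []. Qed.
Lemma fpsN a n : (- a) n = - a n. Proof. by []. Qed.
Lemma fpsMn a k n : (a *+ k) n = a n *+ k.
Proof. by elim: k => [|k IH]; rewrite ?mulr0n// !mulrS fpsD IH. Qed.

Definition fpsX : fps R := fun n => (n == 1)%:R.
Definition fpsC (r : R) : fps R := fun n => if n is 0 then r else 0.

Lemma fpsXM a n : (fpsX * a) n = if n is m.+1 then a m else 0.
Proof.
case: n => [|n]; rewrite fpsM big_ord_recl /fpsX/= mul0r add0r ?big_ord0//.
rewrite big_ord_recl /= mul1r subSS subn0 big1 ?addr0// => i _.
by rewrite mul0r.
Qed.

Lemma fpsXnM k a n :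
  (fpsX ^+ k * a) n = if (k <= n)%N then a (n - k)%N else 0.
Proof.
elim: k n => [|k IH] n; first by rewrite expr0 mul1r subn0.
by rewrite exprS -mulrA fpsXM; case: n => // n; rewrite IH ltnS subSS.
Qed.

Lemma fpsCM (r : R) a n : (fpsC r * a) n = r * a n.
Proof.
rewrite fpsM big_ord_recl/= subn0 big1 ?addr0// => i _; exact: mul0r.
Qed.

Lemma fps_mul0 a b : (a * b) 0 = a 0 * b 0.
Proof. by rewrite fpsM big_ord1 subn0. Qed.

End Fps.

Arguments fpsX {R}.

Section FpsMorph.
Variable R : comNzRingType.
Implicit Types a b : fps R.

Definition fps_scale (c : R) a : fps R := fun n => c ^+ n * a n.

Fact fps_scale_is_additive c : zmod_morphism (fps_scale c).
Proof. by move=> a b; apply/funext => n; rewrite /fps_scale mulrBr. Qed.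

Fact fps_scale_is_multiplicative c : monoid_morphism (fps_scale c).
Proof.
split=> [|a b]; apply/funext => n; rewrite /fps_scale.
  by rewrite fps1; case: n => [|n]; rewrite ?expr0 ?mulr1 ?mulr0.
rewrite !fpsM big_distrr; apply: eq_bigr => i _ /=.
have -> : c ^+ n = c ^+ (n - i) * c ^+ i by rewrite -exprD subnK// -ltnS.
ring.
Qed.

HB.instance Definition _ c :=
  GRing.isZmodMorphism.Build (fps R) (fps R) (fps_scale c) (fps_scale_is_additive c).
HB.instance Definition _ c :=
  GRing.isMonoidMorphism.Build (fps R) (fps R) (fps_scale c)
    (fps_scale_is_multiplicative c).

(** Substitution of [X^d] for [X]. It serves with [d = 3], because [1 + X + X^2] is the quotient of
    [1 - X^3] by [1 - X]. *)
Definition fps_compX (d : nat) a : fps R :=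
  fun n => if (d %| n)%N then a (n %/ d)%N else 0.

Lemma fps_compXM d a b : (0 < d)%N ->
  fps_compX d (a * b) = fps_compX d a * fps_compX d b.
Proof.
move=> d0; apply/funext => n.
have E e k : (k < n.+1)%N -> fps_compX d e k = (fps_trunc n.+1 e \Po 'X^d)`_k.
  move=> kn; rewrite coef_comp_poly_Xn// /fps_compX coef_poly.
  by rewrite (leq_ltn_trans _ kn)// leq_div.
transitivity ((fps_trunc n.+1 a * fps_trunc n.+1 b) \Po 'X^d)`_n.
  rewrite coef_comp_poly_Xn// /fps_compX; case: ifP => // _.
  by rewrite coef_fps_truncM// ltnS leq_div.
rewrite rmorphM coefM fpsM; apply: eq_bigr => i _.
by rewrite !E// ltnS leq_subr.
Qed.

Lemma fps_compX1 d : (0 < d)%N -> fps_compX d 1 = 1 :> fps R.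
Proof.
move=> d0; apply/funext => -[|n]; rewrite /fps_compX fps1 ?dvdn0 ?div0n//.
case: ifP => // dn; rewrite fps1; case: eqP => // /eqP.
by rewrite -leqn0 leqNgt divn_gt0// dvdn_leq.
Qed.

Lemma fps_compXX d : (0 < d)%N -> fps_compX d fpsX = fpsX ^+ d :> fps R.
Proof.
move=> d0; apply/funext => n; rewrite /fps_compX -[fpsX ^+ d]mulr1 fpsXnM fps1 /fpsX.
case: (leqP d n) => dn.
  case: ifP => [/dvdnP[k nE]|]; last first.
    by rewrite subn_eq0; case: leqP => // nd; rewrite (_ : n = d) ?dvdnn//; lia.
  rewrite {}nE mulnK// in dn *; congr (_%:R).
  case: k dn => [|k _]; first lia.
  by rewrite mulSn addKn muln_eq0 (gtn_eqF d0) orbF.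
by case: ifP => // dn'; rewrite divn_small.
Qed.

Lemma fps_compXB d a b : fps_compX d (a - b) = fps_compX d a - fps_compX d b.
Proof.
apply/funext => n; rewrite fpsD fpsN /fps_compX; case: ifP => // _; by rewrite subr0.
Qed.

End FpsMorph.

(** Decides between two opposite square roots of a series: if [h] and [e] have the same square and
    [h + e] has a nonzero constant term, then [h - e] vanishes. *)
Lemma fps_unit_cancel (R : fieldType) (a b : fps R) : a 0%N != 0 -> a * b = 0 -> b = 0.
Proof.
move=> a0 ab; apply/funext => n; rewrite fps0.
elim/ltn_ind: n => n IH; have := congr1 (@^~ n) ab.
rewrite /= fpsM big_ord_recl/= subn0 fps0 big1 ?addr0.
  by move/eqP; rewrite mulf_eq0 (negPf a0) => /eqP.
by move=> i _; rewrite IH ?mulr0// /bump/=; case: n i {IH} => [[]|n i]//; lia.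
Qed.

(* The hypotheses say that [Psi] solves a three-term linear recurrence in [D];
   [K D = Psi D ^+ 2 - B * Psi D * Psi D.+1 + w * Psi D.+1 ^+ 2] satisfies
   [K D = w * K D.+1], so that [K 0] is divisible by every power of the
   indeterminate, hence zero. *)
Lemma fps_kernel_sqr (R : comNzRingType) (Psi : nat -> fps R) (B w w' : fps R) :
  w = fpsX * w' ->
  B * Psi 0%N = 1 + 2 * w * Psi 1%N ->
  (forall D, B * Psi D.+1 = Psi D + w * Psi D.+2) ->
  Psi 0%N ^+ 2 * (B ^+ 2 - 4 * w) = 1.
Proof.
move=> wE H0 HS.
pose K D := Psi D ^+ 2 - B * Psi D * Psi D.+1 + w * Psi D.+1 ^+ 2.
have KS D : K D = w * K D.+1.
  have -> : K D = Psi D * (Psi D - B * Psi D.+1) + w * Psi D.+1 ^+ 2.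
    by rewrite /K; ring.
  rewrite HS opprD addNKr.
  have -> : Psi D = B * Psi D.+1 - w * Psi D.+2 by rewrite HS addrK.
  by rewrite /K; ring.
have KX k : K 0%N = fpsX ^+ k * (w' ^+ k * K k).
  by elim: k => [|k ->]; rewrite ?expr0 ?mul1r// KS wE !exprS; ring.
have K0 : K 0%N = 0 by apply/funext => n; rewrite (KX n.+1) fpsXnM ltnn.
(* The boundary relation eliminates [Psi 1] from the quadratic form:
   [4 w K 0 = 1 - (B^2 - 4 w) Psi 0 ^+ 2]. *)
transitivity (1 - 4 * w * K 0%N); last by rewrite K0 mulr0 subr0.
have -> : 4 * w * K 0%N = 4 * w * Psi 0%N ^+ 2
    - 2 * (B * Psi 0%N) * (2 * w * Psi 1%N) + (2 * w * Psi 1%N) ^+ 2.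
  by rewrite /K; ring.
have -> : 2 * w * Psi 1%N = B * Psi 0%N - 1 by rewrite H0 addrC addKr.
ring.
Qed.

(** * The two kernels *)

Section WhitneyPaths.

(** Summed over [m], these terms count by total weight [N] the paths on the integers from 0 to [D]
    whose up steps weigh 0, level steps 1 or 2, and down steps 3. The case [D = 0] is the sum of
    squares giving the coefficients of [T]; it satisfies a linear recurrence only together with the
    other [D]. *)
Let t N D m := ('C(N - m + D, m) * 'C(N - m + D, m + D))%N.
Let P K N D := (\sum_(m < K) t N D m)%N.

Let P_widen K N D : (N < K)%N -> P K N D = P N.+1 N D.
Proof.
move=> NK; rewrite /P [RHS](big_ord_widen K (t N D))// [RHS]big_mkcond/=.
apply: eq_bigr => m _; case: ifP => // Nm.
by rewrite /t [X in (_ * X)%N]bin_small ?muln0//; lia.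
Qed.

(** The conditional on the right is the coefficient of [fpsX ^+ i] times a series, as in [fpsXnM],
    so the recurrences below read off as identities between series. *)
Let P_shift (i E D N K : nat) (u : nat -> nat) : (N < K)%N ->
  (forall m, (i + m <= N)%N -> u m = t (N - i) E m) ->
  (forall m, (N < i + m)%N -> u m = 0%N) ->
  (\sum_(m < K) u m)%N = if (i <= N)%N then P (N - i).+1 (N - i) E else 0%N.
Proof.
move=> NK uE u0; case: ifP => iN; last first.
  by apply: big1 => m _; apply: u0; lia.
rewrite -(@P_widen K); last lia.
apply: eq_bigr => m _; case: (leqP (i + m) N) => im; first exact: uE.
by rewrite u0// /t [X in (_ * X)%N]bin_small ?muln0//; lia.
Qed.

Let sum_pad K (u : nat -> nat) : u K = 0%N ->
  (\sum_(m < K) u m)%N = (\sum_(m < K.+1) u m)%N.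
Proof. by move=> uK; rewrite big_ord_recr/= uK addn0. Qed.

Let P_rec N D : P N.+1 N D.+1 = (P N.+1 N D
  + (if (1 <= N)%N then P (N - 1).+1 (N - 1) D.+1 else 0)
  + (if (2 <= N)%N then P (N - 2).+1 (N - 2) D.+1 else 0)
  + (if (3 <= N)%N then P (N - 3).+1 (N - 3) D.+2 else 0))%N.
Proof.
pose L m := (N - m + D)%N.
rewrite -(@P_shift 1 D.+1 D N N.+1 (fun m => 'C(L m, m) * 'C(L m, m + D.+1)))%N//; last 2 first.
- by move=> m mN; rewrite /t /L; congr ('C(_, _) * 'C(_, _))%N; lia.
- by move=> m mN; rewrite [X in (_ * X)%N]bin_small ?muln0// /L; lia.
rewrite -(@P_shift 2 D.+1 D N N.+1
  (fun m => 'C(L m.+1, m) * 'C(L m.+1, m.+1 + D)))%N//; last 2 first.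
- by move=> m mN; rewrite /t /L; congr ('C(_, _) * 'C(_, _))%N; lia.
- by move=> m mN; rewrite [X in (_ * X)%N]bin_small ?muln0// /L; lia.
rewrite -(@P_shift 3 D.+2 D N N.+1
  (fun m => 'C(L m.+1, m) * 'C(L m.+1, m.+1 + D.+1)))%N//; last 2 first.
- by move=> m mN; rewrite /t /L; congr ('C(_, _) * 'C(_, _))%N; lia.
- by move=> m mN; rewrite [X in (_ * X)%N]bin_small ?muln0// /L; lia.
rewrite -[P N.+1 N D.+1](@P_widen N.+2)// -[P N.+1 N D](@P_widen N.+2)//.
rewrite (sum_pad (u := fun m => 'C(L m, m) * 'C(L m, m + D.+1)))%N; last first.
  by rewrite /= [X in (_ * X)%N]bin_small ?muln0// /L; clear; lia.
rewrite /P 3!(big_ord_recl N.+1)/= /bump/=.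
have -> : (t N D.+1 0 = t N D 0 + 'C(L 0, 0) * 'C(L 0, 0 + D.+1))%N.
  by rewrite /t /L !subn0 !bin0 !add0n addnS binS !mul1n addnC.
suff -> : (\sum_(i < N.+1) t N D.+1 (1 + i) = \sum_(i < N.+1) t N D (1 + i)
   + \sum_(i < N.+1) 'C(L (1 + i), 1 + i) * 'C(L (1 + i), 1 + i + D.+1)
   + \sum_(i < N.+1) 'C(L i.+1, i) * 'C(L i.+1, i.+1 + D)
   + \sum_(i < N.+1) 'C(L i.+1, i) * 'C(L i.+1, i.+1 + D.+1))%N by ring.
rewrite -!big_split/=; apply: eq_bigr => i _.
rewrite /t !add1n addnS -/(L i.+1) addnS !binS -/(L i.+1).
by rewrite addSn; ring.
Qed.

(** For [D = 0] the two mixed products of Pascal's rule coincide, whence the factor 2. The boolean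
    factors in the proof guard against truncated subtraction: without [m.+1 <= N], the case
    [N = m = 0] would contribute a spurious 1. *)
Let P_rec0 N : P N.+1 N 0 = ((N == 0)
  + (if (1 <= N)%N then P (N - 1).+1 (N - 1) 0 else 0)
  + (if (2 <= N)%N then P (N - 2).+1 (N - 2) 0 else 0)
  + 2 * (if (3 <= N)%N then P (N - 3).+1 (N - 3) 1 else 0))%N.
Proof.
case: N => [|N]; first by rewrite /P big_ord1 /t.
pose L m := (N - m)%N.
rewrite -(@P_shift 1 0 0 N.+1 N.+2
  (fun m => (m <= N) * ('C(L m, m) * 'C(L m, m))))%N//; last 2 first.
- by move=> m mN; rewrite /t /L (_ : m <= N)%N ?mul1n ?addn0 ?addn0 ?subSS ?subn0//; lia.
- by move=> m mN; rewrite leqNgt (_ : N < m)%N//; lia.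
rewrite -(@P_shift 2 0 0 N.+1 N.+1.+1
  (fun m => (m.+1 <= N) * ('C(L m.+1, m) * 'C(L m.+1, m))))%N//; last 2 first.
- move=> m mN; rewrite /t /L (_ : (m.+1 <= N)%N = true); last lia.
  by rewrite mul1n; congr ('C(_, _) * 'C(_, _))%N; lia.
- by move=> m mN; rewrite leqNgt (_ : N < m.+1)%N//; lia.
rewrite -(@P_shift 3 1 0 N.+1 N.+1.+1
  (fun m => 'C(L m.+1, m) * 'C(L m.+1, m.+1)))%N//; last 2 first.
- by move=> m mN; rewrite /t /L; congr ('C(_, _) * 'C(_, _))%N; lia.
- by move=> m mN; rewrite [X in (_ * X)%N]bin_small ?muln0// /L; lia.
rewrite -[P _ _ _](@P_widen N.+3)//.
rewrite (sum_pad (u := fun m => (m <= N) * ('C(L m, m) * 'C(L m, m))))%N; last first.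
  by rewrite /= leqNgt (_ : N < N.+2)%N//; lia.
rewrite /P 2!(big_ord_recl N.+2)/= /bump/= {1}/t /L !subn0 addn0 !bin0 !mul1n add0n.
rewrite -addnA -[RHS]addnA; congr (1 + _)%N.
rewrite big_distrr/= -!big_split/=; apply: eq_bigr => i _.
rewrite /t !add1n !addn0 subSS.
case: (ltnP i N) => iN.
  by rewrite !mul1n (_ : N - i = (N - i.+1).+1)%N ?binS; [ring|lia].
have [-> ->] : (N - i.+1 = 0 /\ N - i = 0)%N by lia.
by rewrite bin_small// !mul0n muln0.
Qed.

Variable R : comNzRingType.

Definition whitney (D : nat) : fps R := fun N =>
  (\sum_(m < N.+1) 'C(N - m + D, m) * 'C(N - m + D, m + D))%N%:R.

Lemma whitney_sqr :
  whitney 0 ^+ 2 * ((1 - fpsX - fpsX ^+ 2) ^+ 2 - 4 * fpsX ^+ 3) = 1.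
Proof.
have ifR (b : bool) (n : nat) : (if b then n else 0)%N%:R = (if b then n%:R else 0) :> R.
  by case: b.
apply: (@fps_kernel_sqr _ whitney _ _ (fpsX ^+ 2)) => [||D]; first by rewrite exprS.
- have : whitney 0 = 1 + fpsX ^+ 1 * whitney 0 + fpsX ^+ 2 * whitney 0
      + 2 * (fpsX ^+ 3 * whitney 1).
    apply/funext => N; rewrite mulr_natl !fpsD fpsMn !fpsXnM fps1 {1}/whitney.
    rewrite -[(\sum_(m < _) _)%N]/(P N.+1 N 0) P_rec0 mul2n -addnn !natrD !ifR.
    by rewrite mulr2n.
  by rewrite expr1 => E; rewrite !mulrBl mul1r [X in X - _ - _]E; ring.
- have : whitney D.+1 = whitney D + fpsX ^+ 1 * whitney D.+1 + fpsX ^+ 2 * whitney D.+1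
      + fpsX ^+ 3 * whitney D.+2.
    apply/funext => N; rewrite !fpsD !fpsXnM {1}/whitney.
    rewrite -[(\sum_(m < _) _)%N]/(P N.+1 N D.+1) P_rec !natrD !ifR.
    by [].
  by rewrite expr1 => E; rewrite !mulrBl mul1r [X in X - _ - _]E; ring.
Qed.

End WhitneyPaths.

Section CentralBinomial.
Variable R : numFieldType.

(** The coefficients of [(1 - X)^(-1/2)], equal to the rising factorial of 1/2 divided by [n!]. *)
Definition half_pochhammer : fps R := fun n => 'C(n.*2, n)%:R / 4 ^+ n.

(** Second use of the kernel lemma, with [B = 1] and [w = X] (paths without level steps). It yields
    the inverse square root of [1 - 4 X], and scaling [X] by 1/4 finishes. *)
Lemma half_pochhammer_sqr : half_pochhammer ^+ 2 * (1 - fpsX) = 1.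
Proof.
pose Psi D : fps R := fun n => 'C(n.*2 + D, n)%:R.
have : Psi 0%N ^+ 2 * (1 ^+ 2 - 4 * fpsX) = 1.
  apply: (@fps_kernel_sqr _ _ _ _ 1) => [||D]; first by rewrite mulr1.
  - apply/funext => n; rewrite mul1r -mulrA mulr_natl fpsD fpsMn fpsXM fps1 /Psi.
    case: n => [|n]; first by rewrite bin0 mul0rn addr0.
    have E : 'C(n.*2.+1, n.+1) = 'C(n.*2.+1, n).
      rewrite -bin_sub; last lia.
      by congr 'C(_, _); lia.
    by rewrite addn0 add0r doubleS binS E addn1 natrD mulr2n.
  - apply/funext => n; rewrite mul1r fpsD fpsXM /Psi.
    case: n => [|n]; first by rewrite !bin0 addr0.
    rewrite addnS binS natrD; congr (_ + _%:R); congr 'C(_, _); lia.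
move/(congr1 (fps_scale (4^-1))); rewrite expr1n rmorph1 rmorphM rmorphXn rmorphB rmorph1/=.
rewrite [fps_scale _ (Psi _)](_ : _ = half_pochhammer); last first.
  by apply/funext => n; rewrite /fps_scale /Psi /half_pochhammer addn0 mulrC exprVn.
rewrite [fps_scale _ _](_ : _ = fpsX)//.
apply/funext => n; rewrite /fps_scale mulr_natl fpsMn /fpsX.
case: n => [|[|n]]/=; rewrite ?mul0rn ?mulr0// expr1.
by apply: mulVf; rewrite pnatr_eq0.
Qed.

End CentralBinomial.
Arguments half_pochhammer {R}.

(** * Coefficient asymptotics *)

Section CvgBig.
Variables (R : realType) (I : Type) (r : seq I) (f : I -> nat -> R) (l : I -> R).
Hypothesis fl : forall i, f i n @[n --> \oo] --> l i.

Lemma cvgn_sum : \sum_(i <- r) f i n @[n --> \oo] --> \sum_(i <- r) l i.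
Proof.
elim: r => [|i s IH].
  by under eq_fun do rewrite big_nil; rewrite big_nil; exact: cvg_cst.
by under eq_fun do rewrite big_cons; rewrite big_cons; exact: cvgD.
Qed.

Lemma cvgn_prod : \prod_(i <- r) f i n @[n --> \oo] --> \prod_(i <- r) l i.
Proof.
elim: r => [|i s IH].
  by under eq_fun do rewrite big_nil; rewrite big_nil; exact: cvg_cst.
by under eq_fun do rewrite big_cons; rewrite big_cons; exact: cvgM.
Qed.

End CvgBig.

Section FastSeries.
Variable R : realType.
Implicit Types a b : fps R.

(* The weight [2 k + 1] dominates the ratios [c (n - k) / c n] for the
   coefficients [c] of [(1 - X) ^ (- q - 1/2)]. *)
Definition fps_fast a :=
  exists C, forall n, \sum_(k < n) `|a k| * (2 * k + 1)%N%:R <= C.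

Definition fps_sum a : R := limn (series a).

Lemma sum_triangle_le (f g : nat -> R) n :
  (forall i, 0 <= f i) -> (forall i, 0 <= g i) ->
  \sum_(k < n) \sum_(i < k.+1) f i * g (k - i)%N <=
  (\sum_(i < n) f i) * (\sum_(i < n) g i).
Proof.
move=> f0 g0; rewrite big_distrl/=.
under eq_bigr => k _.
  rewrite (big_ord_widen n (fun i => f i * g (k - i)%N)) //.
  over.
rewrite /= (exchange_big_dep xpredT)//=; apply: ler_sum => i _.
rewrite -big_distrr/=; apply: ler_wpM2l => //.
rewrite (eq_bigl (fun k : 'I_n => xpredT (k : nat) && (i <= k)%N)) => [|k]; last first.
  by rewrite ltnS.
rewrite -(big_geq_mkord i n xpredT (fun k => g (k - i)%N)) -[X in \sum_(X <= _ < _) _]add0n.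
rewrite big_addn big_mkord; under [leLHS]eq_bigr do rewrite addnK.
rewrite (big_ord_widen n g) ?leq_subr// big_mkcond/=; apply: ler_sum => j _.
by case: ifP.
Qed.

(** The weight is submultiplicative, [2 (i + j) + 1 <= (2 i + 1) (2 j + 1)], hence so is the
    weighted norm. *)
Lemma fps_fastM a b : fps_fast a -> fps_fast b -> fps_fast (a * b).
Proof.
move=> [A aA] [B bB]; exists (A * B) => n.
pose f i := `|a i| * (2 * i + 1)%N%:R; pose g i := `|b i| * (2 * i + 1)%N%:R.
have f0 i : 0 <= f i by rewrite mulr_ge0.
have g0 i : 0 <= g i by rewrite mulr_ge0.
apply: (@le_trans _ _ (\sum_(k < n) \sum_(i < k.+1) f i * g (k - i)%N)).
  apply: ler_sum => k _; rewrite fpsM.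
  apply: (@le_trans _ _ ((\sum_(i < k.+1) `|a i| * `|b (k - i)%N|) * (2 * k + 1)%N%:R)).
    apply: ler_wpM2r => //; apply: (le_trans (ler_norm_sum _ _ _)).
    by apply: ler_sum => i _; rewrite normrM.
  rewrite big_distrl/=; apply: ler_sum => i _; rewrite /f /g mulrACA.
  apply: ler_wpM2l; first exact: mulr_ge0.
  have ik : (i <= k)%N by rewrite -ltnS.
  by rewrite -natrM ler_nat; nia.
apply: (le_trans (sum_triangle_le n f0 g0)).
by apply: ler_pM; [apply: sumr_ge0 => i _|apply: sumr_ge0 => i _|exact: aA|exact: bB].
Qed.

Lemma fps_fast_scale (c : R) a : 0 <= c < 1 -> (forall n, `|a n| <= 1) ->
  fps_fast (fps_scale c a).
Proof.
move=> /andP[c0 c1] a1; have d0 : 0 < 1 - c by rewrite subr_gt0.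
(* Chosen so that [be - c^n (al n + be)] is exactly the sum of [c^k (2 k + 1)] over [k < n]. *)
pose al := 2 / (1 - c); pose be := (1 + c * al) / (1 - c).
have al0 : 0 <= al by apply: divr_ge0 => //; exact: ltW.
have be0 : 0 <= be.
  by apply: divr_ge0; [apply: addr_ge0 => //; exact: mulr_ge0|exact: ltW].
exists be => n.
suff : \sum_(k < n) `|fps_scale c a k| * (2 * k + 1)%N%:R <= be - c ^+ n * (al * n%:R + be).
  move=> /le_trans; apply; rewrite lerBlDr lerDl mulr_ge0 ?exprn_ge0//.
  by rewrite addr_ge0// mulr_ge0.
elim: n => [|n IH]; first by rewrite big_ord0 expr0 mulr0 add0r mul1r subrr.
rewrite big_ord_recr/=; apply: (@le_trans _ _ (be - c ^+ n * (al * n%:R + be)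
   + c ^+ n * (2 * n + 1)%N%:R)).
  apply: lerD => //; rewrite /fps_scale normrM (ger0_norm (exprn_ge0 _ c0)).
  by apply: ler_wpM2r => //; rewrite ler_piMr// exprn_ge0.
have alE : al * (1 - c) = 2 by rewrite divfK// gt_eqF.
have beE : be * (1 - c) = 1 + c * al by rewrite divfK// gt_eqF.
have -> : (2 * n + 1)%N%:R = al * (1 - c) * n%:R + (be * (1 - c) - c * al).
  by rewrite alE beE addrK natrD natrM.
by rewrite le_eqVlt -natr1 exprS; apply/orP; left; apply/eqP; ring.
Qed.

Lemma fps_fast_abs a : fps_fast a -> exists C, forall n, \sum_(k < n) `|a k| <= C.
Proof.
move=> [C aC]; exists C => n; apply: le_trans (aC n); apply: ler_sum => k _.
by rewrite ler_peMr// ler1n addn1.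
Qed.

Lemma bounded_series_cvg (u : nat -> R) C : (forall k, 0 <= u k) ->
  (forall n, \sum_(k < n) u k <= C) -> cvgn (series u).
Proof.
move=> u0 uC; apply: nondecreasing_is_cvgn.
  apply/nondecreasing_seqP => n; rewrite /series/= big_nat_recr//= lerDl; exact: u0.
by exists C => _ [n _ <-]; rewrite /series/= big_mkord.
Qed.

Lemma fps_fast_cvg a : fps_fast a -> cvgn (series a).
Proof.
move=> /fps_fast_abs[C aC]; apply: normed_cvg.
exact: (@bounded_series_cvg (fun k => `|a k|) C).
Qed.

(* Tannery's theorem, dominated by the weights. *)
Lemma fps_fast_dominated a (d : nat -> nat -> R) (l C : R) : fps_fast a ->
  (forall k, d n k @[n --> \oo] --> l) ->
  (forall n k, (k <= n)%N -> `|d n k| <= C * (2 * k + 1)%N%:R) ->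
  \sum_(k < n.+1) a k * d n k @[n --> \oo] --> fps_sum a * l.
Proof.
move=> fa dl dC.
have suml : \sum_(k < n.+1) a k * l @[n --> \oo] --> fps_sum a * l.
  rewrite (_ : (fun n => _) = (fun n => series a n.+1 * l)); last first.
    by apply/funext => n; rewrite /series/= big_mkord mulr_suml.
  apply: cvgMl; rewrite (cvg_shiftS (series a)).
  exact: fps_fast_cvg.
rewrite (_ : (fun n => _) = (fun n => \sum_(k < n.+1) a k * (d n k - l)) \+
    (fun n => \sum_(k < n.+1) a k * l)); last first.
  apply/funext => n /=; rewrite -big_split/=; apply: eq_bigr => k _.
  by rewrite -mulrDr subrK.
rewrite -[X in _ --> X]add0r; apply: cvgD suml.
move: (fa) => [A aA].
pose w k : R := `|a k| * (2 * k + 1)%N%:R.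
have w0 k : 0 <= w k by rewrite mulr_ge0.
have wcvg : cvgn (series w) := bounded_series_cvg w0 aA.
pose C' := Num.max C 0 + `|l|.
have C'0 : 0 <= C' by rewrite addr_ge0// le_max lexx orbT.
have dC' n k : (k <= n)%N -> `|a k * (d n k - l)| <= C' * w k.
  move=> kn; rewrite normrM /w mulrCA; apply: ler_wpM2l => //.
  apply: (le_trans (ler_normB _ _)); rewrite mulrDl; apply: lerD.
    by apply: (le_trans (dC _ _ kn)); apply: ler_wpM2r; rewrite // le_max lexx.
  by rewrite ler_peMr// ler1n addn1.
apply/cvgrPdist_lt => e e0.
have [K _ HK] : \forall K \near \oo, C' * (limn (series w) - series w K) < e / 2.
  apply: (@cvgr_lt _ _ _ _ (fun K => C' * (limn (series w) - series w K)) 0).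
    rewrite -[X in _ --> X](mulr0 C') -(subrr (limn (series w))).
    by apply: cvgMr; apply: cvgB => //; exact: cvg_cst.
  by rewrite divr_gt0.
have {}HK := HK K (leqnn K).
have headl : \sum_(k < K) `|a k * (d n k - l)| @[n --> \oo] --> (0 : R).
  rewrite [X in _ --> X](_ : 0 = \sum_(k < K) (0 : R)); last by rewrite big1.
  apply: (@cvgn_sum _ _ _ (fun (k : 'I_K) n => `|a k * (d n k - l)|) (fun=> 0)) => k.
  rewrite -[X in _ --> X](normr0 R); apply: cvg_norm.
  rewrite -[X in _ --> X](mulr0 (a k)) -(subrr l).
  by apply: cvgMr; apply: cvgB => //; exact: cvg_cst.
have headlt := cvgr_lt _ headl _ (divr_gt0 e0 (ltr0Sn R 1)).
near=> n; rewrite sub0r normrN.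
apply: (le_lt_trans (ler_norm_sum _ _ _)).
have Kn : (K <= n.+1)%N by near: n; exists K => // m /= /leqW.
rewrite -(big_mkord xpredT (fun k => `|a k * (d n k - l)|)) (big_cat_nat _ Kn)//=.
rewrite [e]splitr; apply: ltr_leD.
  by rewrite big_mkord; near: n; exact: headlt.
apply: le_trans (ltW HK).
apply: (@le_trans _ _ (\sum_(K <= i < n.+1) C' * w i)).
  by rewrite big_nat_cond [leRHS]big_nat_cond; apply: ler_sum => k /andP[/andP[_ kn] _]; exact: dC'.
rewrite -mulr_sumr; apply: ler_wpM2l => //.
rewrite -sub_series_geq//; apply: lerB => //.
apply: nondecreasing_cvgn_le => //.
by apply/nondecreasing_seqP => m; rewrite /series/= big_nat_recr//= lerDl.
Unshelve. all: by end_near. Qed.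

(** Multiplying by the constant series [ones], the inverse of [1 - X], produces partial sums. By
    associativity the partial sums of [a * b] are the convolution of [a] with the partial sums of
    [b], to which dominated convergence applies. *)
Lemma fps_sumM a b : fps_fast a -> fps_fast b ->
  fps_sum (a * b) = fps_sum a * fps_sum b.
Proof.
move=> fa fb; apply/cvg_lim => //; rewrite -(cvg_shiftS (series _)).
pose d n k := if (k <= n)%N then series b (n - k).+1 else 0.
have E : (fun n => series (a * b) n.+1) = (fun n => \sum_(k < n.+1) a k * d n k).
  pose ones : fps R := fun=> 1.
  have onesM e n : (e * ones) n = series e n.+1.
    by rewrite fpsM /series/= big_mkord; apply: eq_bigr => i _; rewrite mulr1.
  apply/funext => n; rewrite -onesM -mulrA fpsM; apply: eq_bigr => i _.
  by rewrite onesM /d -ltnS ltn_ord.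
rewrite E; have [B bB] := fps_fast_abs fb.
have B0 : 0 <= B by have := bB 0%N; rewrite big_ord0.
apply: (@fps_fast_dominated _ _ _ B) => // [k|n k kn].
  rewrite -(cvg_shiftn k); under eq_fun do rewrite /d leq_addl addnK.
  by have : series b n @[n --> \oo] --> fps_sum b := fps_fast_cvg fb; rewrite -cvg_shiftS.
rewrite /d kn; apply: (@le_trans _ _ B); last first.
  by rewrite ler_peMr// ler1n addn1.
rewrite /series/= big_mkord; apply: le_trans (bB (n - k).+1).
exact: ler_norm_sum.
Qed.

Lemma fps_fast_poly2 a : (forall k, (2 < k)%N -> a k = 0) ->
  fps_fast a /\ fps_sum a = a 0%N + a 1%N + a 2%N.
Proof.
move=> a0; split.
  pose w k := `|a k| * (2 * k + 1)%N%:R.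
  exists (\sum_(k < 3) w k) => n; rewrite -(big_mkord xpredT w) -(big_mkord xpredT w).
  have [n3|n3] := leqP n 3.
    rewrite [leRHS](big_cat_nat _ n3)//= lerDl sumr_ge0// => k _; exact: mulr_ge0.
  rewrite (big_cat_nat _ (ltnW n3))//= [X in _ + X]big_nat_cond [X in _ + X]big1 ?addr0// => k.
  by move=> /andP[/andP[k3 _] _]; rewrite /w a0// normr0 mul0r.
apply/cvg_lim => //; rewrite -(cvg_shiftn 3).
rewrite (_ : (fun n => _) = (fun=> a 0%N + a 1%N + a 2%N)); first exact: cvg_cst.
apply/funext => n; rewrite /series/= addnC big_mkord big_split_ord/= [X in _ + X]big1 ?addr0.
  by rewrite 3!big_ord_recl big_ord0/= addr0 addrA.
by move=> i _; exact: a0.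
Qed.

Lemma fps_fast1 : fps_fast 1 /\ fps_sum 1 = 1.
Proof.
have [] := @fps_fast_poly2 1 => [k k2|f ->]; first by rewrite fps1; case: k k2.
by split=> //; rewrite !fps1 !addr0.
Qed.

Lemma fps_fastX a k : fps_fast a -> fps_fast (a ^+ k) /\ fps_sum (a ^+ k) = fps_sum a ^+ k.
Proof.
move=> fa; elim: k => [|k [IH1 IH2]]; first exact: fps_fast1.
by rewrite !exprS -IH2 fps_sumM//; split=> //; exact: fps_fastM.
Qed.

End FastSeries.

Section InvHalfPow.
Variable R : realType.

Lemma cvg_ratio_shift (a b : R) : (n%:R + a) / (n%:R + b) @[n --> \oo] --> (1 : R).
Proof.
have H c : (n%:R + c) / n.+1%:R @[n --> \oo] --> (1 : R).
  rewrite (_ : (fun n => _) = (fun n => 1 + (c - 1) * harmonic n)); last first.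
    apply/funext => n; rewrite /harmonic/= -natr1.
    by field; rewrite natr1.
  rewrite [X in _ --> X](_ : 1 = 1 + (c - 1) * 0); last by rewrite mulr0 addr0.
  apply: cvgD; first exact: cvg_cst.
  by apply: cvgMr; exact: cvg_harmonic.
rewrite (_ : (fun n => _) =
    (fun n => ((n%:R + a) / n.+1%:R) * ((n%:R + b) / n.+1%:R)^-1)); last first.
  apply/funext => n; rewrite invfM invrK mulrACA mulrC -mulrA.
  by rewrite mulVf ?mulr1 1?mulrC// pnatr_eq0.
rewrite -[X in _ --> X]divr1; by apply: cvgM => //; apply: cvgV.
Qed.

(* The coefficients of [(1 - X) ^ (- q - 1/2)]. *)
Definition inv_half_pow (q : nat) : fps R := fun n =>
  \prod_(i < n) (((q + i)%:R + 2^-1) / i.+1%:R).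

Lemma inv_half_powS q n :
  inv_half_pow q n.+1 = inv_half_pow q n * (((q + n)%:R + 2^-1) / n.+1%:R).
Proof. by rewrite /inv_half_pow big_ord_recr. Qed.

Lemma nat_half_gt0 (n : nat) : 0 < n%:R + 2^-1 :> R.
Proof. by rewrite ltr_wpDl ?invr_gt0. Qed.

Lemma inv_half_pow_gt0 q n : 0 < inv_half_pow q n.
Proof. by apply: prodr_gt0 => i _; rewrite divr_gt0 ?nat_half_gt0. Qed.

Lemma inv_half_pow0 : inv_half_pow 0 = half_pochhammer.
Proof.
apply/funext => n; rewrite /half_pochhammer; elim: n => [|n IH].
  by rewrite /inv_half_pow big_ord0 bin0 expr0 divr1.
have E : (n.+1 * 'C(n.+1.*2, n.+1) = 2 * n.*2.+1 * 'C(n.*2, n))%N.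
  have E1 : (n.+1 * 'C(n.*2.+1, n.+1) = n.*2.+1 * 'C(n.*2, n))%N.
    by rewrite mul_bin_diag.
  have E2 : 'C(n.*2.+1, n) = 'C(n.*2.+1, n.+1).
    rewrite -[RHS]bin_sub; last lia.
    by congr 'C(_, _); lia.
  by rewrite doubleS binS E2 mulnDr E1 -mulnA -mul2n; lia.
rewrite inv_half_powS IH exprSr add0n.
have n0 : n.+1%:R != 0 :> R by rewrite pnatr_eq0.
have e0 : 4 ^+ n != 0 :> R by rewrite expf_neq0// pnatr_eq0.
have {}E : n.+1%:R * 'C(n.+1.*2, n.+1)%:R = 2 * (2 * n%:R + 1) * 'C(n.*2, n)%:R :> R.
  by rewrite -natrM E -[n.*2.+1]addn1 -[in LHS]mul2n 2!natrM natrD natrM mul2n.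
apply: (mulfI n0); rewrite [RHS]mulrA E.
move: e0 n0; rewrite -[n.+1]addn1 natrD; move: (n%:R : R) (4 ^+ n : R) => y x x0 y0.
by field; rewrite x0 y0.
Qed.

(** Source of the growth: each further division by [1 - X] multiplies the coefficient by a factor
    linear in [n], and the denominators accumulate to [(1/2)(3/2)...]. *)
Lemma inv_half_pow_ratio q n : inv_half_pow q.+1 n =
  inv_half_pow q n * (((q + n)%:R + 2^-1) / (q%:R + 2^-1)).
Proof.
have q0 := lt0r_neq0 (nat_half_gt0 q).
elim: n => [|n IH]; first by rewrite /inv_half_pow !big_ord0 addn0 mul1r divff.
rewrite !inv_half_powS IH addSnnS.
by rewrite -!mulrA; congr (_ * _); ring.
Qed.

Lemma mulXB_inv_half_pow q : (1 - fpsX) * inv_half_pow q.+1 = inv_half_pow q.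
Proof.
apply/funext => n; rewrite mulrBl mul1r fpsD fpsN fpsXM.
have q0 := lt0r_neq0 (nat_half_gt0 q).
case: n => [|n]; first by rewrite subr0 /inv_half_pow !big_ord0.
rewrite !inv_half_pow_ratio inv_half_powS addnS.
have n0 : n.+1%:R != 0 :> R by rewrite pnatr_eq0.
rewrite -!mulrA -mulrBr; congr (_ * _).
move: n0 q0; rewrite -[(q + n).+1%N]addn1 -![n.+1]addn1 !natrD.
set x := n%:R; set y := q%:R => n0 q0.
field.
by rewrite n0 -/y (_ : y * 2 + 1 = 2 * (y + 2^-1)) ?mulf_neq0 ?pnatr_eq0//; field.
Qed.

(** Both sides satisfy the same relation under multiplication by [1 - X]. This gives odd powers of
    [(1 - X)^(-1/2)] coefficients in product form. *)
Lemma inv_half_powE q : inv_half_pow q = half_pochhammer ^+ q.*2.+1.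
Proof.
elim: q => [|q IH]; first by rewrite inv_half_pow0 expr1.
rewrite doubleS (exprD _ 2) -IH -(mulXB_inv_half_pow q).
by rewrite mulrA half_pochhammer_sqr mul1r.
Qed.

(** The induction step amounts to [(2 k + 1) (n + k + 1) <= (2 k + 3) (q + n + k + 1/2)], which
    holds already for [q = n = 0]. *)
Lemma inv_half_pow_dominated q n k :
  inv_half_pow q n <= (2 * k + 1)%N%:R * inv_half_pow q (n + k)%N.
Proof.
elim: k => [|k IH]; first by rewrite addn0 mul1r.
apply: (le_trans IH); rewrite (addnS n) inv_half_powS mulrCA mulrC.
apply: ler_wpM2l; first exact/ltW/inv_half_pow_gt0.
rewrite mulrA ler_pdivlMr// -[k.+1]addn1 -[(n + k).+1%N]addn1 !natrD.
have := ler0n R q; have := ler0n R n; have := ler0n R k.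
by set x := k%:R; set y := n%:R; set z := q%:R; nra.
Qed.

Lemma half_pochhammer_le1 n : `|half_pochhammer n : R| <= 1.
Proof.
rewrite -inv_half_pow0 gtr0_norm ?inv_half_pow_gt0//.
elim: n => [|n]; first by rewrite /inv_half_pow big_ord0.
apply: le_trans; rewrite inv_half_powS ler_piMr//; first exact/ltW/inv_half_pow_gt0.
by rewrite ler_pdivrMr// mul1r add0n -[n.+1]addn1 natrD lerD2l; lra.
Qed.

Lemma cvg_inv_half_pow_shift q k :
  inv_half_pow q n / inv_half_pow q (n + k)%N @[n --> \oo] --> (1 : R).
Proof.
elim: k => [|k IH].
  under eq_fun do rewrite addn0 divff ?gt_eqF ?inv_half_pow_gt0//.
  exact: cvg_cst.
rewrite (_ : (fun n => _) = (fun n => inv_half_pow q n / inv_half_pow q (n + k)%N *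
    ((n%:R + k.+1%:R) / (n%:R + (q%:R + k%:R + 2^-1))))); last first.
  apply/funext => n; rewrite (addnS n) inv_half_powS invfM mulrA; congr (_ * _).
  rewrite invf_div -natrD addnS; congr (_ / _).
  by rewrite !natrD; ring.
rewrite -[X in _ --> X]mulr1; apply: cvgM => //; exact: cvg_ratio_shift.
Qed.

(** The transfer theorem: writing [c] for [inv_half_pow q], the quotient is the sum of
    [a k * (c (n - k) / c n)], where each ratio tends to 1 and is bounded by the weight
    [2 k + 1]. *)
Lemma cvg_fast_inv_half_pow (a : fps R) q : fps_fast a ->
  (a * inv_half_pow q) n / inv_half_pow q n @[n --> \oo] --> fps_sum a.
Proof.
move=> fa.
pose d n k := if (k <= n)%N then inv_half_pow q (n - k)%N / inv_half_pow q n else 0.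
rewrite (_ : (fun n => _) = (fun n => \sum_(k < n.+1) a k * d n k)); last first.
  apply/funext => n; rewrite fpsM mulr_suml; apply: eq_bigr => i _.
  by rewrite /d -ltnS ltn_ord mulrA.
rewrite -[X in _ --> X]mulr1; apply: (@fps_fast_dominated _ _ _ _ 1) => // [k|n k kn].
  rewrite -(cvg_shiftn k); under eq_fun do rewrite /d leq_addl addnK.
  exact: cvg_inv_half_pow_shift.
rewrite /d kn mul1r ger0_norm; last by rewrite ltW// divr_gt0// inv_half_pow_gt0.
rewrite ler_pdivrMr ?inv_half_pow_gt0//.
by rewrite -[X in _ * inv_half_pow q X](subnK kn) inv_half_pow_dominated.
Qed.

End InvHalfPow.

Section FpsConst.
Variable R : comNzRingType.

Fact fpsC_is_additive : zmod_morphism (@fpsC R).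
Proof. by move=> a b; apply/funext => -[|n]; rewrite fpsD fpsN /fpsC ?subr0. Qed.

Fact fpsC_is_multiplicative : monoid_morphism (@fpsC R).
Proof.
by split=> [|a b]; apply/funext => -[|n]; rewrite ?fpsCM /fpsC ?mulr0.
Qed.

HB.instance Definition _ :=
  GRing.isZmodMorphism.Build R (fps R) (@fpsC R) fpsC_is_additive.
HB.instance Definition _ :=
  GRing.isMonoidMorphism.Build R (fps R) (@fpsC R) fpsC_is_multiplicative.

Lemma fps_scaleX (c : R) : fps_scale c fpsX = fpsC c * fpsX.
Proof.
apply/funext => n; rewrite fpsCM /fps_scale /fpsX.
by case: n => [|[|n]]; rewrite ?mulr0 ?expr1.
Qed.

End FpsConst.

(** * Square root singularity of the kernel series *)

Section WhitneyAsymptotics.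
Variables (R : realType) (rho : R).
Hypotheses (rho01 : 0 < rho < 1) (rhoE : rho ^+ 2 + 1 = 3 * rho).
Local Notation X := (@fpsX R).
Local Notation b := (@half_pochhammer R).
Local Notation r := (fpsC rho).
Let W : fps R := fps_scale rho (whitney R 0).
(** The cofactor of [1 - X] in the radicand at [z = rho X]: since [rho^2 + 1 = 3 rho], the factor
    [1 - 3 z + z^2] becomes [(1 - X) (1 - rho^2 X)]. *)
Let P : fps R := (1 - r ^+ 2 * X) * (1 + r * X + r ^+ 2 * X ^+ 2).

Let rE : r ^+ 2 + 1 = 3 * r.
Proof.
have := congr1 (@fpsC R) rhoE.
by rewrite rmorphD rmorphXn rmorph1 rmorphM/= rmorph_nat.
Qed.

Let W_sqr : W ^+ 2 * ((1 - X) * P) = 1.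
Proof.
have := congr1 (fps_scale rho) (whitney_sqr R).
rewrite !(rmorphM, rmorphXn, rmorphB, rmorph_nat, rmorph1)/= -/W fps_scaleX => E.
rewrite -[RHS]E; congr (_ * _); rewrite /P.
transitivity ((1 - (r ^+ 2 + 1) * X + r ^+ 2 * X ^+ 2) * (1 + r * X + r ^+ 2 * X ^+ 2)).
  ring.
by rewrite rE; ring.
Qed.

(** An explicit inverse square root of [P]. The first factor treats [1 - rho^2 X]; the others come
    from [(1 + X + X^2)^(-1/2) = (1 - X) b(X) b(X^3)], taken at [rho X]. Every factor is scaled by a
    number below 1, hence is fast. *)
Let e : fps R := fps_scale (rho ^+ 2) b *
  (fps_scale rho (1 - X) * (fps_scale rho b * fps_scale rho (fps_compX 3 b))).

Let e_sqr : e ^+ 2 * P = 1.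
Proof.
have e1 : fps_scale (rho ^+ 2) b ^+ 2 * (1 - r ^+ 2 * X) = 1.
  have := congr1 (fps_scale (rho ^+ 2)) (half_pochhammer_sqr R).
  by rewrite !(rmorphM, rmorphXn, rmorphB, rmorph1)/= fps_scaleX rmorphXn.
have e2 : fps_scale rho b ^+ 2 * fps_scale rho (1 - X) = 1.
  by rewrite -rmorphXn -rmorphM/= half_pochhammer_sqr rmorph1.
have e3 : fps_scale rho (fps_compX 3 b) ^+ 2 *
    (fps_scale rho (1 - X) * (1 + r * X + r ^+ 2 * X ^+ 2)) = 1.
  have -> : 1 + r * X + r ^+ 2 * X ^+ 2 = fps_scale rho (1 + X + X ^+ 2).
    by rewrite !(rmorphD, rmorphXn, rmorph1)/= fps_scaleX; ring.
  rewrite -rmorphM -rmorphXn -rmorphM/=.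
  have -> : (1 - X) * (1 + X + X ^+ 2) = fps_compX 3 (1 - X).
    by rewrite fps_compXB fps_compX1// fps_compXX//; ring.
  by rewrite expr2 -!fps_compXM// -expr2 half_pochhammer_sqr fps_compX1// rmorph1.
transitivity ((fps_scale (rho ^+ 2) b ^+ 2 * (1 - r ^+ 2 * X)) *
    (fps_scale rho b ^+ 2 * fps_scale rho (1 - X)) *
    (fps_scale rho (fps_compX 3 b) ^+ 2 *
     (fps_scale rho (1 - X) * (1 + r * X + r ^+ 2 * X ^+ 2)))); last first.
  by rewrite e1 e2 e3 !mulr1.
by rewrite /e /P; ring.
Qed.

Let h : fps R := W * (1 - X) * b.

Let W_E : W = h * b.
Proof.
by rewrite /h -!mulrA -expr2 [(1 - X) * _]mulrC half_pochhammer_sqr mulr1.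
Qed.

(** Both are square roots of the inverse of [P] with constant term 1. Summability of [h] is visible
    only on [e]. *)
Let h_e : h = e.
Proof.
have h_sqr : h ^+ 2 * P = 1.
  transitivity (W ^+ 2 * ((1 - X) * P) * (b ^+ 2 * (1 - X))); last first.
    by rewrite W_sqr half_pochhammer_sqr mulr1.
  by rewrite /h; ring.
apply/eqP; rewrite -subr_eq0; apply/eqP.
have P0 : P 0%N = 1.
  rewrite (_ : P = (1 - X * r ^+ 2) * (1 + X * (r + r ^+ 2 * X))); last by rewrite /P; ring.
  by rewrite fps_mul0 !fpsD fpsN !fps1 !fpsXM subr0 addr0 mul1r.
have b0 : b 0%N = 1 by rewrite /half_pochhammer bin0 expr0 divr1.
have h0 : h 0%N = 1.
  rewrite /h !fps_mul0 fpsD fpsN fps1 b0 subr0 !mulr1 /W /fps_scale expr0 mul1r.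
  by rewrite /whitney big_ord1.
have e0 : e 0%N = 1.
  by rewrite /e !fps_mul0 /fps_scale !expr0 !mul1r /fps_compX/= b0 fpsD fpsN fps1 subr0 !mulr1.
apply: (@fps_unit_cancel _ ((h + e) * P)).
  by rewrite fps_mul0 P0 fpsD h0 e0 mulr1 -(natrD _ 1 1) pnatr_eq0.
transitivity (h ^+ 2 * P - e ^+ 2 * P); first by ring.
by rewrite h_sqr e_sqr subrr.
Qed.

Let fast_h : fps_fast h.
Proof.
have /andP[/ltW r0 r1] := rho01.
have r1' : rho ^+ 2 < 1 by rewrite expr_lt1.
rewrite h_e; apply: fps_fastM; last apply: fps_fastM; last apply: fps_fastM.
- apply: fps_fast_scale => [|n]; first by rewrite exprn_ge0.
  exact: half_pochhammer_le1.
- apply: fps_fast_scale => [|[|[|n]]]; first exact/andP.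
  + by rewrite fpsD fpsN fps1 subr0 normr1.
  + by rewrite fpsD fpsN fps1 /fpsX/= sub0r normrN normr1.
  + by rewrite fpsD fpsN fps1 /fpsX/= subrr normr0.
- apply: fps_fast_scale => [|n]; first exact/andP.
  exact: half_pochhammer_le1.
- apply: fps_fast_scale => [|n]; first exact/andP.
  by rewrite /fps_compX; case: ifP => _; rewrite ?normr0//; exact: half_pochhammer_le1.
Qed.

(** The identity [h^2 P = 1] evaluated at [X = 1], where [fps_sum] is multiplicative on fast
    series. *)
Let sum_h : fps_sum h ^+ 2 * ((1 - rho ^+ 2) * (1 + rho + rho ^+ 2)) = 1.
Proof.
have [f1 s1] : fps_fast (1 - r ^+ 2 * X) /\ fps_sum (1 - r ^+ 2 * X) = 1 - rho ^+ 2.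
  have E k : (1 - r ^+ 2 * X) k = (k == 0)%:R - rho ^+ 2 * (k == 1)%:R.
    by rewrite fpsD fpsN fps1 -rmorphXn fpsCM.
  have [k k2|f ->] := @fps_fast_poly2 _ (1 - r ^+ 2 * X).
    by rewrite E; case: k k2 => [|[|k]]//= _; rewrite mulr0 subr0.
  by split=> //; rewrite !E/=; ring.
have [f2 s2] : fps_fast (1 + r * X + r ^+ 2 * X ^+ 2) /\
    fps_sum (1 + r * X + r ^+ 2 * X ^+ 2) = 1 + rho + rho ^+ 2.
  have E k : (1 + r * X + r ^+ 2 * X ^+ 2) k =
      (k == 0)%:R + rho * (k == 1)%:R + rho ^+ 2 * (k == 2)%:R.
    rewrite !fpsD fps1 -rmorphXn !fpsCM -[X ^+ 2]mulr1 fpsXnM fps1.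
    by congr (_ + _ * _); case: k => [|[|[|k]]].
  have [k k2|f ->] := @fps_fast_poly2 _ (1 + r * X + r ^+ 2 * X ^+ 2).
    by rewrite E; case: k k2 => [|[|[|k]]]//= _; rewrite !mulr0 !addr0.
  by split=> //; rewrite !E/=; ring.
have [fh sh] := fps_fastX 2 fast_h.
rewrite -sh -s1 -s2 -!fps_sumM//; last exact: fps_fastM.
by rewrite -/P h_e e_sqr; have [_] := fps_fast1 R.
Qed.

(** The product of half-integers cancels the denominators accumulated in [inv_half_pow_ratio]. *)
Lemma fact_double_half q : (q.*2)`!%:R = 4 ^+ q * q`!%:R * \prod_(i < q) (i%:R + 2^-1) :> R.
Proof.
elim: q => [|q IH]; first by rewrite big_ord0 mulr1 expr0 mul1r.
rewrite doubleS !factS big_ord_recr/= !natrM IH exprS.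
rewrite -[q.*2.+2]addn2 -[q.*2.+1]addn1 -[q.+1]addn1 !natrD -muln2 natrM.
by field.
Qed.

Lemma whitney_gt0 n : 0 < whitney R 0 n.
Proof.
rewrite /whitney ltr0n big_ord_recl lt0n addn_eq0 negb_and; apply/orP; left.
by rewrite !bin0.
Qed.

(** The quotient is the factorial moment of order [2q] at [N = n + 4q], normalized by [(N + 1)^q];
    the shift [4q] comes from [z^(2r)] with [r = 2q]. It splits into a transfer factor tending to
    [h(1)^(2q+1)], a shift ratio tending to 1, the factor of the denominator tending to [h(1)^-1],
    and a product of [q] linear ratios. *)
Lemma cvg_whitney_moment q :
  (q.*2)`!%:R * (whitney R 0 ^+ q.*2.+1) n / whitney R 0 (n + 4 * q)%N
    / (n + 4 * q).+1%:R ^+ q @[n --> \oo] -->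
  q`!%:R * (4 * rho ^+ 4 / ((1 - rho ^+ 2) * (1 + rho + rho ^+ 2))) ^+ q.
Proof.
have /andP[rho0 _] := rho01.
set D := (_ * (1 + _ + _)).
have eta0 : fps_sum h != 0.
  by apply/eqP => E; move/eqP: sum_h; rewrite E expr0n mul0r eq_sym oner_eq0.
have [fhq shq] := fps_fastX q.*2.+1 fast_h.
have lim1 := cvg_fast_inv_half_pow q fhq.
have lim2 := cvg_inv_half_pow_shift (R := R) 0 (4 * q).
have lim3 : (inv_half_pow R 0 n / W n) @[n --> \oo] --> (fps_sum h)^-1.
  rewrite (_ : (fun n => _) =
      (fun n => ((h * inv_half_pow R 0) n / inv_half_pow R 0 n)^-1)); last first.
    by apply/funext => n; rewrite inv_half_pow0 -W_E invf_div.
  exact: cvgV eta0 (cvg_fast_inv_half_pow 0 fast_h).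
move: lim3; rewrite -(cvg_shiftn (4 * q)) => lim3.
have lim4 : \prod_(i < q) ((n%:R + (i%:R + 2^-1)) / (n%:R + (4 * q + 1)%N%:R) / (i%:R + 2^-1))
    @[n --> \oo] --> \prod_(i < q) (1 / (i%:R + 2^-1 : R)).
  apply: (@cvgn_prod _ _ _ (fun (i : 'I_q) n =>
    (n%:R + (i%:R + 2^-1)) / (n%:R + (4 * q + 1)%N%:R) / (i%:R + 2^-1))) => i.
  by apply: cvgMl; exact: cvg_ratio_shift.
have q0 : \prod_(i < q) (i%:R + 2^-1 : R) != 0.
  by apply/prodf_neq0 => i _; exact: lt0r_neq0 (nat_half_gt0 R i).
rewrite [X in _ --> X](_ : _ = (q.*2)`!%:R * rho ^+ (4 * q) *
    (fps_sum (h ^+ q.*2.+1) * 1 * (fps_sum h)^-1 * \prod_(i < q) (1 / (i%:R + 2^-1)))); last first.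
  have eD : fps_sum h ^+ 2 = D^-1.
    have D0 : D != 0.
      by apply/eqP => E; move/eqP: sum_h; rewrite -/D E mulr0 eq_sym oner_eq0.
    by apply: (mulIf D0); rewrite sum_h mulVf.
  rewrite shq prodf_div big1_eq mulr1 fact_double_half.
  rewrite (exprS (fps_sum h)) -mul2n (exprM (fps_sum h)) eD (exprM rho) !exprMn.
  by field; rewrite q0 eta0.
rewrite (_ : (fun n => _) = (fun n => (q.*2)`!%:R * rho ^+ (4 * q) *
    ((h ^+ q.*2.+1 * inv_half_pow R q) n / inv_half_pow R q n *
     (inv_half_pow R 0 n / inv_half_pow R 0 (n + 4 * q)%N) *
     (inv_half_pow R 0 (n + 4 * q)%N / W (n + 4 * q)%N) *
     \prod_(i < q) ((n%:R + (i%:R + 2^-1)) / (n%:R + (4 * q + 1)%N%:R) / (i%:R + 2^-1))))).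
  by apply: cvgMr; apply: cvgM lim4; apply: cvgM lim3; apply: cvgM lim1 lim2.
apply/funext => n.
set m := (n + 4 * q)%N.
have WE k l : (W ^+ k) l = rho ^+ l * (whitney R 0 ^+ k) l.
  by rewrite /W -rmorphXn.
have rn k : rho ^+ k != 0 by rewrite expf_neq0// gt_eqF.
have prodE : \prod_(i < q) ((n%:R + (i%:R + 2^-1)) / (n%:R + (4 * q + 1)%N%:R) / (i%:R + 2^-1))
    = inv_half_pow R q n / inv_half_pow R 0 n / m.+1%:R ^+ q.
  have -> : inv_half_pow R q n = inv_half_pow R 0 n *
      \prod_(i < q) ((n%:R + (i%:R + 2^-1)) / (i%:R + 2^-1)).
    elim: q {fhq shq lim1 lim2 lim3 lim4 q0 m} => [|k IH]; first by rewrite big_ord0 mulr1.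
    rewrite inv_half_pow_ratio IH big_ord_recr/= -mulrA; congr (_ * (_ * (_ / _))).
    by rewrite natrD addrCA addrA.
  rewrite [_ / inv_half_pow R 0 n]mulrAC mulfV ?gt_eqF ?inv_half_pow_gt0// mul1r.
  have -> : (m.+1%:R ^+ q)^-1 = \prod_(i < q) (m.+1%:R^-1 : R).
    by rewrite prodr_const card_ord exprVn.
  rewrite -big_split/=; apply: eq_bigr => i _.
  by rewrite mulrAC /m -natrD addnA addn1.
(* The numerator reassembles as [h^(2q+1) b^(2q+1) = W^(2q+1)]; all auxiliary coefficients then
   cancel. *)
rewrite prodE inv_half_powE -exprMn -W_E -inv_half_powE WE.
have -> : W m = rho ^+ n * rho ^+ (4 * q) * whitney R 0 m.
  by rewrite /W /fps_scale -exprD.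
have := inv_half_pow_gt0 R q n; have := inv_half_pow_gt0 R 0 n.
have := inv_half_pow_gt0 R 0 m; have := whitney_gt0 m.
have := rn n; have := rn (4 * q)%N.
have := expf_neq0 q (_ : m.+1%:R != 0 :> R); rewrite pnatr_eq0 => /(_ isT).
move: ((q.*2)`!%:R : R) (rho ^+ n) (rho ^+ (4 * q)) (inv_half_pow R q n)
  (inv_half_pow R 0 n) (inv_half_pow R 0 m) (whitney R 0 m)
  ((whitney R 0 ^+ q.*2.+1) n) (m.+1%:R ^+ q) => F r1 r2 c1 c2 c3 w1 w2 N.
move=> N0 r10 r20 /lt0r_neq0 w10 /lt0r_neq0 c30 /lt0r_neq0 c20 /lt0r_neq0 c10.
by field; rewrite c10 c20 c30 w10 r10 r20 N0.
Qed.

End WhitneyAsymptotics.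

(** * Pairs of monotone sequences *)

(* Pairs of weakly decreasing sequences of length [m], the first bounded by [p]
   and the second by [q], stored as sequences of pairs. *)
Fixpoint decr_pairs (m p q : nat) : seq (seq (nat * nat)) :=
  if m is m'.+1 then
    [seq ab :: s | ab <- [seq (a, b) | a <- iota 0 p.+1, b <- iota 0 q.+1],
                   s <- decr_pairs m' ab.1 ab.2]
  else [:: [::]].

Arguments decr_pairs : simpl never.

Lemma decr_pairsS m p q : decr_pairs m.+1 p q =
  [seq ab :: s | ab <- [seq (a, b) | a <- iota 0 p.+1, b <- iota 0 q.+1],
                 s <- decr_pairs m ab.1 ab.2].
Proof. by []. Qed.

Definition coincidences (s : seq (nat * nat)) : nat := count (fun ab => ab.1 == ab.2) s.

Definition geq_pair (ab cd : nat * nat) := (cd.1 <= ab.1)%N && (cd.2 <= ab.2)%N.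

Lemma mem_decr_pairs m p q s :
  (s \in decr_pairs m p q) = (size s == m) && path geq_pair (p, q) s.
Proof.
elim: m p q s => [|m IH] p q [|[a b] s] //.
  by apply/negbTE/negP; rewrite decr_pairsS => /allpairsPdep[x [y [_ _]]].
rewrite decr_pairsS [size _]/= eqSS [path _ _ _]/=.
apply/idP/idP => [/allpairsPdep[[a' b'] [s' [+ s'in [-> -> ->]]]]|].
  move=> /allpairsPdep[x [y [xin yin [? ?]]]]; subst a' b'.
  move: s'in; rewrite IH => /andP[-> /= ->]; move: xin yin.
  by rewrite !mem_iota /geq_pair /= !add0n !ltnS => -> ->.
move=> /andP[sm /andP[/andP[ap bq] ps]]; apply/allpairsPdep; exists (a, b), s; split => //.
  by apply: allpairs_f; rewrite mem_iota.
by rewrite IH sm.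
Qed.

Lemma uniq_decr_pairs m p q : uniq (decr_pairs m p q).
Proof.
elim: m p q => [//|m IH] p q; rewrite decr_pairsS.
apply: allpairs_uniq_dep => //; last by move=> [x1 y1] [x2 y2] _ _ /= [-> ->].
by apply: allpairs_uniq; rewrite ?iota_uniq// => -[? ?] [? ?] _ _ [-> ->].
Qed.

Definition marked_pairs (r m p q : nat) : nat :=
  (\sum_(s <- decr_pairs m p q) 'C(coincidences s, r))%N.

Section MarkedPairs.
Local Open Scope nat_scope.

Let sum_box (F : nat * nat -> nat) p q :
  \sum_(ab <- [seq (a, b) | a <- iota 0 p.+1, b <- iota 0 q.+1]) F ab =
  \sum_(a < p.+1) \sum_(b < q.+1) F (nat_of_ord a, nat_of_ord b).
Proof.
rewrite big_allpairs -[iota 0 p.+1]/(index_iota 0 p.+1) big_mkord.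
by apply: eq_bigr => a _; rewrite -[iota 0 q.+1]/(index_iota 0 q.+1) big_mkord.
Qed.

Lemma marked_pairsS r m p q : marked_pairs r m.+1 p q =
  \sum_(a < p.+1) \sum_(b < q.+1) \sum_(s <- decr_pairs m a b)
    'C((a == b :> nat) + coincidences s, r).
Proof.
rewrite /marked_pairs decr_pairsS big_allpairs_dep/= -(sum_box (fun ab =>
  \sum_(s <- decr_pairs m ab.1 ab.2) 'C((ab.1 == ab.2) + coincidences s, r))).
by apply: eq_bigr => ab _.
Qed.

Lemma hockey_stick i p : \sum_(a < p.+1) 'C(i + a, i) = 'C(i.+1 + p, i.+1).
Proof.
elim: p => [|p IH]; first by rewrite big_ord1 !addn0 !binn.
by rewrite big_ord_recr/= IH [in RHS]addSn binS addSnnS.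
Qed.

Lemma marked_pairs0 m p q : marked_pairs 0 m p q = 'C(m + p, m) * 'C(m + q, m).
Proof.
elim: m p q => [|m IH] p q; first by rewrite /marked_pairs big_seq1 !bin0.
rewrite marked_pairsS -!hockey_stick big_distrl; apply: eq_bigr => a _.
rewrite big_distrr; apply: eq_bigr => b _ /=; rewrite -IH /marked_pairs.
by apply: eq_bigr => s _; rewrite !bin0.
Qed.

Let sum_shift (f : nat -> nat) p v : v <= p ->
  \sum_(a < p.+1 | v <= a) f (a - v) = \sum_(a < (p - v).+1) f a.
Proof.
move=> vp; rewrite -(big_geq_mkord v p.+1 xpredT (fun a => f (a - v))).
rewrite -{1}[v]add0n big_addn big_mkord subSn//.
by apply: eq_bigr => i _; rewrite addnK.
Qed.

Let sum_swap (P Q : nat -> nat -> bool) (F : nat -> nat -> nat -> nat) p q M :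
  \sum_(a < p) \sum_(b < q) \sum_(v < M | P a v && Q b v) F a b v =
  \sum_(v < M) \sum_(a < p | P a v) \sum_(b < q | Q b v) F a b v.
Proof.
transitivity (\sum_(a < p) \sum_(v < M) \sum_(b < q)
    if P a v && Q b v then F a b v else 0).
  apply: eq_bigr => a _; rewrite [RHS]exchange_big/=; apply: eq_bigr => b _.
  by rewrite big_mkcond.
rewrite exchange_big/=; apply: eq_bigr => v _; rewrite [RHS]big_mkcond/=.
apply: eq_bigr => a _; case: (P a v); last by rewrite big1.
by rewrite [RHS]big_mkcond.
Qed.

(** Cut at the first marked coincidence, at position [i] with common value [v]. What precedes it is
    unmarked and at least [v], so it is lowered by [v]; what follows is bounded by [v] in both
    coordinates. Equal bounds thus reappear after each mark, so the diagonal series suffice. *)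
Lemma marked_pairs_first r m p q : marked_pairs r.+1 m p q =
  \sum_(i < m) \sum_(v < (minn p q).+1)
    marked_pairs 0 i (p - v) (q - v) * marked_pairs r (m - i.+1) v v.
Proof.
elim: m p q => [|m IH] p q; first by rewrite big_ord0 /marked_pairs big_seq1 bin0n.
rewrite marked_pairsS [RHS]big_ord_recl/= subSS subn0.
have diag : \sum_(a < p.+1) \sum_(b < q.+1) (a == b :> nat) * marked_pairs r m a a =
    \sum_(v < (minn p q).+1) marked_pairs r m v v.
  have mp : (minn p q).+1 <= p.+1 by rewrite ltnS geq_minl.
  rewrite (big_ord_widen p.+1 (fun v => marked_pairs r m v v)) // [RHS]big_mkcond/=.
  apply: eq_bigr => a _; rewrite ltnS leq_min -[a <= p]ltnS ltn_ord/= -big_distrl/=.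
  case: (leqP a q) => aq.
    rewrite (bigD1 (Ordinal (aq : a < q.+1)))//= eqxx big1 ?addn0 ?mul1n// => b bn.
    by case: eqP => // E; case/eqP: bn; apply/val_inj.
  by rewrite big1 ?mul0n// => b _; case: eqP => // E; have := ltn_ord b; rewrite -E; lia.
(* For a first pair with [a = b], Pascal's rule separates whether that pair carries the first
   mark. *)
rewrite (eq_bigr (fun a : 'I_p.+1 => \sum_(b < q.+1) marked_pairs r.+1 m a b +
   \sum_(b < q.+1) (a == b :> nat) * marked_pairs r m a a)); last first.
  move=> a _; rewrite -big_split/=; apply: eq_bigr => b _; rewrite /marked_pairs.
  case: eqP => [->|_]; last by rewrite mul0n addn0.
  by rewrite mul1n -big_split/=; apply: eq_bigr => s _; rewrite add1n binS.
rewrite big_split/= diag addnC; congr addn.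
  by apply: eq_bigr => v _; rewrite marked_pairs0 !bin0 !mul1n.
under eq_bigr => a _ do under eq_bigr => b _ do rewrite IH.
under eq_bigr => a _ do rewrite exchange_big/=.
rewrite exchange_big/=; apply: eq_bigr => i _.
set M := (minn p q).+1.
transitivity (\sum_(a < p.+1) \sum_(b < q.+1) \sum_(v < M | (v <= a) && (v <= b))
    marked_pairs 0 i (a - v) (b - v) * marked_pairs r (m - i.+1) v v).
  apply: eq_bigr => a _; apply: eq_bigr => b _.
  rewrite (big_ord_widen M (fun v => marked_pairs 0 i (a - v) (b - v) *
    marked_pairs r (m - i.+1) v v)); last first.
    by rewrite /M ltnS leq_min; have := ltn_ord a; have := ltn_ord b; lia.
  by apply: eq_bigl => v; rewrite ltnS leq_min.
rewrite (sum_swap (fun a v => v <= a) (fun b v => v <= b) (fun a b v =>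
  marked_pairs 0 i (a - v) (b - v) * marked_pairs r (m - i.+1) v v)).
apply: eq_bigr => v _.
have [vp vq] : v <= p /\ v <= q.
  by have := ltn_ord v; rewrite /M ltnS leq_min => /andP[].
rewrite /bump/= add1n subSS.
(* Summing over a first pair with both entries at least [v] lengthens the unmarked prefix from [i]
   to [i.+1], by the hockey-stick identity in each coordinate. *)
under eq_bigr => a va.
  rewrite -big_distrl/=.
  under eq_bigr => b _ do rewrite marked_pairs0.
  rewrite -big_distrr/= (sum_shift (fun b => 'C(i + b, i)) vq) hockey_stick.
  over.
rewrite -big_distrl/= -big_distrl/= (sum_shift (fun a => 'C(i + a, i)) vp) hockey_stick.
by rewrite marked_pairs0.
Qed.

End MarkedPairs.

Section Diagonal.
Variable R : comNzRingType.
Implicit Types f g : nat -> nat -> R.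

(* The specialization [x = X ^+ 2], [y = X] of the bivariate series of
   coefficients [f m j]. *)
Definition fps_diag f : fps R := fun N =>
  \sum_(m < N.+1 | (m.*2 <= N)%N) f m (N - m.*2)%N.

Definition conv2 f g m j : R :=
  \sum_(i < m.+1) \sum_(v < j.+1) f i v * g (m - i)%N (j - v)%N.

Let coef_horner_X2 (P : {poly {poly R}}) N :
  P.['X^2]`_N = \sum_(m < N.+1 | (m.*2 <= N)%N) P`_m`_(N - m.*2).
Proof.
rewrite (@horner_coef_wide _ (size P + N.+1)) ?leq_addr// coef_sum.
have E m : (P`_m * 'X^2 ^+ m)`_N = if (m.*2 <= N)%N then P`_m`_(N - m.*2) else 0.
  by rewrite -exprM mul2n coefMXn ltnNge; case: leqP.
under eq_bigr do rewrite E.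
rewrite [RHS]big_mkcond/=.
rewrite [RHS](big_ord_widen (size P + N.+1)
  (fun m => if (m.*2 <= N)%N then P`_m`_(N - m.*2) else 0)) ?leq_addl//.
rewrite [RHS]big_mkcond/=; apply: eq_bigr => m _.
by case: leqP => // mN; case: ltnP => //; lia.
Qed.

(** The specialization is a ring morphism: on truncations it is evaluation at ['X^2] of a polynomial
    with polynomial coefficients. *)
Lemma fps_diagM f g : fps_diag (conv2 f g) = fps_diag f * fps_diag g.
Proof.
apply/funext => N.
pose F h : {poly {poly R}} := \poly_(m < N.+1) \poly_(j < N.+1) h m j.
have FC h m j : (m < N.+1)%N -> (j < N.+1)%N -> (F h)`_m`_j = h m j.
  by move=> mN jN; rewrite coef_poly mN coef_poly jN.
have FE h k : (k < N.+1)%N -> (F h).['X^2]`_k = fps_diag h k.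
  move=> kN; rewrite coef_horner_X2 /fps_diag; apply: eq_bigr => m mk; have := ltn_ord m => mk'.
  by rewrite FC//; lia.
have -> : fps_diag (conv2 f g) N = (F f * F g).['X^2]`_N.
  rewrite coef_horner_X2 /fps_diag; apply: eq_bigr => m mk; rewrite coefM coef_sum.
  apply: eq_bigr => i _; rewrite coefM; apply: eq_bigr => v _.
  by have := ltn_ord m; have := ltn_ord i; have := ltn_ord v => *; rewrite !FC//; lia.
rewrite hornerM coefM fpsM; apply: eq_bigr => i _.
by rewrite !FE//; have := ltn_ord i; lia.
Qed.

Lemma fps_diag_shift f :
  fps_diag (fun m j => if m is m'.+1 then f m' j else 0) = fpsX ^+ 2 * fps_diag f.
Proof.
apply/funext => N; rewrite fpsXnM /fps_diag big_mkcond big_ord_recl/= add0r.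
case: N => [|[|N]]; first by rewrite big_ord0.
  by rewrite big_ord1.
rewrite subSS subSS subn0 big_ord_recr/= [X in _ + X](_ : _ = 0) ?addr0; last first.
  by case: ifP => //; rewrite /bump/=; lia.
rewrite [RHS]big_mkcond; apply: eq_bigr => i _; rewrite /bump/= add1n doubleS.
by rewrite !ltnS subSS.
Qed.

End Diagonal.

Section MarkedSeries.
Variable R : comNzRingType.

Definition marked_series (r : nat) : fps R :=
  fps_diag (fun m j => (marked_pairs r m j j)%:R).

Lemma marked_series0 : marked_series 0 = whitney R 0.
Proof.
apply/funext => N; rewrite /marked_series /fps_diag /whitney -natr_sum; congr (_%:R).
rewrite big_mkcond/=; apply: eq_bigr => m _; rewrite !addn0.
case: leqP => mN; last by rewrite bin_small//; have := ltn_ord m; lia.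
by rewrite marked_pairs0; congr ('C(_, _) * 'C(_, _))%N; lia.
Qed.

(** With equal bounds, [marked_pairs_first] is a convolution in both length and bound. The marked
    pair itself uses one unit of length, which [fps_diag] records as [X^2]. *)
Lemma marked_seriesS r : marked_series r.+1 = fpsX ^+ 2 * (whitney R 0 * marked_series r).
Proof.
rewrite -marked_series0 /marked_series -fps_diagM -fps_diag_shift; congr fps_diag.
apply/funext => -[|m]; apply/funext => j.
  by rewrite marked_pairs_first big_ord0.
rewrite marked_pairs_first minnn natr_sum; apply: eq_bigr => i _.
rewrite natr_sum subSS (reindex_inj rev_ord_inj)/=; apply: eq_bigr => v _.
rewrite subSS natrM; have := ltn_ord v => vj.
by rewrite (_ : j - (j - v) = v)%N; last lia.
Qed.

Lemma marked_seriesE r : marked_series r = fpsX ^+ r.*2 * whitney R 0 ^+ r.+1.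
Proof.
elim: r => [|r IH]; first by rewrite marked_series0 mul1r expr1.
by rewrite marked_seriesS IH doubleS (exprD _ 2 r.*2) (exprS _ r.+1); ring.
Qed.

End MarkedSeries.

(** * Bargraphs as pairs of monotone sequences *)

Section Bargraphs.
Local Open Scope nat_scope.

Fixpoint rises (y : nat) (hs : seq nat) : nat :=
  if hs is h :: hs' then (h - y) + rises h hs' else 0.

Lemma n_steps_rises (B : bargraph) : n_steps B = rises 0 B.
Proof.
rewrite /n_steps /upper_boundary; move: (columns B) 0 => hs.
elim: hs => [|h hs IH] y /=; first by elim: y.
rewrite !count_cat /= IH; congr addn.
  by elim: (h - y) => //= n ->.
by rewrite [X in X + _](_ : _ = 0)//; elim: (y - h).
Qed.

Lemma e_steps_size (B : bargraph) : e_steps B = size B.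
Proof.
rewrite /e_steps /upper_boundary; move: (columns B) 0 => hs.
elim: hs => [|h hs IH] y /=; first by elim: y.
rewrite !count_cat /= IH [X in X + _](_ : _ = 0); last by elim: (h - y).
by rewrite [X in 0 + (X + _)](_ : _ = 0)//; elim: (y - h).
Qed.

Lemma rises_cat y l r : rises y (l ++ r) = rises y l + rises (last y l) r.
Proof. by elim: l y => [|h l IH] y //=; rewrite IH addnA. Qed.

Lemma rises_incr y l : path leq y l -> rises y l = last y l - y.
Proof.
elim: l y => [|h l IH] y /=; first by rewrite subnn.
move=> /andP[yh hl]; rewrite IH//.
have : h <= last h l.
  by elim: l h {IH yh} hl => //= a l IH h /andP[ha al]; apply: (leq_trans ha); exact: IH.
lia.
Qed.

Lemma rises_decr y r : path geq y r -> rises y r = 0.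
Proof. by elim: r y => //= h r IH y /andP[hy hr]; rewrite IH// addn0; lia. Qed.

Lemma rises_unimodal l r : sorted leq l -> sorted geq r ->
  rises 0 (l ++ r) = maxn (last 0 l) (head 0 r).
Proof.
move=> sl sr; rewrite rises_cat rises_incr; last by case: l sl => //= a l ->.
case: r sr => [|h r] /= sr; first by rewrite subn0 addn0 maxn0.
by rewrite rises_decr//; lia.
Qed.

(** For odd size the two slices share the central column; for even size they are disjoint and the
    two central heights are not compared. *)
Lemma unimodal_sorted (B : bargraph) : unimodal_centered_max B <->
  sorted leq (take (uphalf (size B)) B) /\ sorted geq (drop (size B)./2 B).
Proof.
rewrite /unimodal_centered_max /height /=; set k := size B.
split=> [[H1 H2]|[/(sortedP 0) H1 /(sortedP 0) H2]]; split.
- apply/(sortedP 0) => i; rewrite size_take -/k => ik.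
  have ik' : i.+1 < uphalf k by move: ik; case: ifP => //; have := uphalf_half k; lia.
  by rewrite !nth_take ?(ltnW ik')//; apply: (H1 i.+1).
- apply/(sortedP 0) => i; rewrite size_drop -/k !nth_drop => ik.
  have := H2 (k./2 + i).+1; rewrite /= addnS; apply.
  by rewrite ltnS leq_addr; lia.
- case=> // i /andP[_ ik]; have ik' : i.+1 < uphalf k by [].
  have := H1 i; rewrite size_take -/k !nth_take ?(ltnW ik')//; apply.
  by case: ifP => //; have := uphalf_half k; lia.
- case=> [|i] /andP[ki ik]; first by move: ki.
  have {}ki : k./2 <= i by move: ki; rewrite ltnS.
  have := H2 (i - k./2); rewrite size_drop -/k !nth_drop addnS subnKC//; apply.
  by lia.
Qed.

(** Entries are heights minus one and [j = N - 2m]. Semiperimeter [N + 1] forces a central column,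
    if present, to have height [j], so the entries are below [j]; with none, the largest height is
    [j + 1], so the largest entry is [j]. The two parities therefore share out the pairs bounded by
    [j] according to whether [j] is attained. The empty pair gives a single column. *)
Definition columns_of_pairs (N : nat) (s : seq (nat * nat)) : seq nat :=
  let j := N - (size s).*2 in
  rev [seq ab.1.+1 | ab <- s] ++
  (if (0 < size s) && (maxn (head (0, 0) s).1 (head (0, 0) s).2 == j) then [::] else [:: j])
  ++ [seq ab.2.+1 | ab <- s].

Definition pairs_of_columns (c : seq nat) : seq (nat * nat) :=
  zip [seq h.-1 | h <- rev (take (size c)./2 c)]
      [seq h.-1 | h <- drop (uphalf (size c)) c].

(* [m] columns on either side and [N - 2 m + 1] possible heights of the sides. *)
Definition all_pairs (N : nat) : seq (seq (nat * nat)) :=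
  [seq s | m <- iota 0 N./2.+1, s <- decr_pairs m (N - m.*2) (N - m.*2)].

Lemma mem_all_pairs N s : (s \in all_pairs N) =
  ((size s).*2 <= N) && path geq_pair (N - (size s).*2, N - (size s).*2) s.
Proof.
apply/allpairsPdep/andP => [[m [t [mN tm ->]]]|[sN ps]].
  move: mN tm; rewrite mem_iota mem_decr_pairs => /andP[_ mN] /andP[/eqP -> ->].
  by split=> //; have := odd_double_half N; lia.
exists (size s), s; rewrite mem_decr_pairs eqxx; split=> //.
by rewrite mem_iota; have := odd_double_half N; lia.
Qed.

Lemma uniq_all_pairs N : uniq (all_pairs N).
Proof.
apply: allpairs_uniq_dep => [|m _|]; [exact: iota_uniq|exact: uniq_decr_pairs|].
move=> x y /allpairsPdep[m [t [_ + ->]]] /allpairsPdep[m' [t' [_ + ->]]] /= tt'.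
by rewrite -tt' !mem_decr_pairs => /andP[/eqP <- _] /andP[/eqP <- _].
Qed.

Lemma path_geq_pair p q s : path geq_pair (p, q) s =
  path geq p (unzip1 s) && path geq q (unzip2 s).
Proof.
elim: s p q => //= -[a b] s IH p q /=; rewrite IH /geq_pair/=.
by rewrite -!andbA; do 2 bool_congr; rewrite andbCA.
Qed.

Lemma size_columns_of_pairs N s : exists2 mid : seq nat, size mid <= 1 &
  columns_of_pairs N s = rev [seq ab.1.+1 | ab <- s] ++ mid ++ [seq ab.2.+1 | ab <- s].
Proof.
rewrite /columns_of_pairs; set mid := if _ then _ else _; exists mid => //.
by rewrite /mid; case: ifP.
Qed.

Lemma take_half_cat (L M T : seq nat) : size L = size T -> size M <= 1 ->
  let c := L ++ M ++ T in
  [/\ take (size c)./2 c = L, drop (uphalf (size c)) c = T,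
      take (uphalf (size c)) c = L ++ M & drop (size c)./2 c = M ++ T].
Proof.
move=> LT M1 c.
have sc : size c = (size L).*2 + size M by rewrite /c !size_cat -LT; lia.
have h1 : (size c)./2 = size L by rewrite sc; lia.
have h2 : uphalf (size c) = size (L ++ M).
  by rewrite size_cat sc; lia.
split; rewrite ?h1 ?h2 /c.
- by rewrite take_size_cat.
- by rewrite catA drop_size_cat.
- by rewrite catA take_size_cat.
- by rewrite drop_size_cat.
Qed.

Lemma columns_of_pairsK N : cancel (columns_of_pairs N) pairs_of_columns.
Proof.
move=> s; have [M M1 ->] := size_columns_of_pairs N s; rewrite /pairs_of_columns.
have [|-> -> _ _] := @take_half_cat (rev [seq ab.1.+1 | ab <- s]) M [seq ab.2.+1 | ab <- s] _ M1.
  by rewrite size_rev !size_map.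
rewrite revK -!map_comp /comp/=; elim: s => //= -[a b] s IH.
by rewrite IH.
Qed.

(** Positivity makes the predecessor injective on heights, so equal columns and equal entries
    correspond. *)
Lemma degree_of_symmetry_pairs (B : bargraph) :
  all (leq 1) B -> degree_of_symmetry B = coincidences (pairs_of_columns B).
Proof.
move=> /allP B1; rewrite /degree_of_symmetry /coincidences /pairs_of_columns /height.
set k := size B.
have sL : size (take k./2 B) = k./2 by rewrite size_take -/k; case: ifP => //; lia.
have sR : size (drop (uphalf k) B) = k./2.
  by rewrite size_drop -/k; have := odd_double_half k; rewrite uphalf_half; lia.
set s := zip _ _.
have ss : size s = k./2 by rewrite size_zip !size_map size_rev sL sR minnn.
(* Indices are listed from the centre outwards, the order of the pairs. *)
have -> : iota 1 k./2 = rev [seq k./2 - t | t <- iota 0 k./2].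
  apply: (@eq_from_nth _ 0); first by rewrite size_rev size_map !size_iota.
  move=> i; rewrite size_iota => ik; rewrite nth_iota//.
  rewrite nth_rev size_map size_iota// (nth_map 0) ?size_iota; last lia.
  by rewrite nth_iota; lia.
rewrite -[s](mkseq_nth (0, 0)) /mkseq ss count_rev !count_map; apply: eq_in_count => t.
rewrite mem_iota => /andP[_ tk] /=.
rewrite nth_zip ?size_map ?size_rev ?sL ?sR//= !(nth_map 0) ?size_rev ?sL ?sR//.
rewrite nth_rev ?sL// nth_take ?nth_drop; last lia.
have nz i : i < k -> 0 < nth 0 B i by move=> ik; apply/B1/mem_nth.
have kh := odd_double_half k; have ku := uphalf_half k.
have -> : (k.+1 - (k./2 - t)).-1 = uphalf k + t by lia.
have -> : (k./2 - t).-1 = k./2 - t.+1 by lia.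
have := nz (k./2 - t.+1); have := nz (uphalf k + t).
by lia.
Qed.

(** For [N = 0] the empty pair would give a column of height 0, whence [0 < N]. *)
Lemma columns_of_pairs_valid N s (c := columns_of_pairs N s) : 0 < N -> s \in all_pairs N ->
  [/\ (0 < size c) && all (leq 1) c,
      sorted leq (take (uphalf (size c)) c),
      sorted geq (drop (size c)./2 c) & size c + rises 0 c = N.+1].
Proof.
move=> N0; rewrite mem_all_pairs path_geq_pair; set j := N - _ => /and3P[sN pa pb].
have sa : sorted geq (unzip1 s) := path_sorted pa.
have sb : sorted geq (unzip2 s) := path_sorted pb.
have E1 : [seq ab.1.+1 | ab <- s] = [seq x.+1 | x <- unzip1 s] by rewrite -map_comp.
have E2 : [seq ab.2.+1 | ab <- s] = [seq x.+1 | x <- unzip2 s] by rewrite -map_comp.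
have [z1 z2] : size (unzip1 s) = size s /\ size (unzip2 s) = size s by rewrite !size_map.
have sbS : sorted geq [seq x.+1 | x <- unzip2 s] by rewrite sorted_map.
have sL : sorted leq (rev [seq x.+1 | x <- unzip1 s]) by rewrite rev_sorted sorted_map.
have pos : all (leq 1) (rev [seq x.+1 | x <- unzip1 s]) && all (leq 1) [seq x.+1 | x <- unzip2 s].
  by rewrite all_rev !all_map; apply/andP; split; apply/allP.
have szc : size (rev [seq x.+1 | x <- unzip1 s]) = size [seq x.+1 | x <- unzip2 s].
  by rewrite size_rev !size_map.
rewrite /c /columns_of_pairs -/j E1 E2; case: ifP => [/andP[s0 /eqP mj]|].
  have [|//|_ _ -> ->] := @take_half_cat (rev [seq x.+1 | x <- unzip1 s]) [::]
    [seq x.+1 | x <- unzip2 s]; first exact: szc.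
  rewrite cats0 !cat0s all_cat pos size_cat size_rev !(size_map succn) z1 z2.
  split=> //; first by lia.
  rewrite rises_unimodal//.
  have -> : last 0 (rev [seq x.+1 | x <- unzip1 s]) = (head (0, 0) s).1.+1.
    by move: s0; case: (s) => //= x t _; rewrite rev_cons last_rcons.
  have -> : head 0 [seq x.+1 | x <- unzip2 s] = (head (0, 0) s).2.+1.
    by move: s0; case: (s).
  by rewrite maxnSS mj addnn addnS subnKC.
move=> Hj; have [|//|_ _ -> ->] := @take_half_cat (rev [seq x.+1 | x <- unzip1 s]) [:: j]
    [seq x.+1 | x <- unzip2 s]; first exact: szc.
have [j0 [pja pjb]] : 0 < j /\ path geq j [seq x.+1 | x <- unzip1 s] /\
    path geq j [seq x.+1 | x <- unzip2 s].
  move: Hj pa pb sa sb; rewrite /j; case: (s) => [|[a b] s'] /=.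
    by rewrite double0 subn0.
  move=> /negbT mj /andP[ja pa] /andP[jb pb] _ _.
  by rewrite !path_map pa pb; split; [|split]; rewrite ?andbT /=; lia.
have sLj : sorted leq (rev [seq x.+1 | x <- unzip1 s] ++ [:: j]).
  by rewrite cats1 -rev_cons rev_sorted.
have /andP[p1 p2] := pos.
rewrite !all_cat p1 p2 /= j0 !size_cat/= size_rev !(size_map succn) z1 z2.
split=> //; first by rewrite addnS.
rewrite -cat_rcons -cats1 rises_unimodal//.
rewrite cats1 last_rcons.
have -> : maxn j (head 0 [seq x.+1 | x <- unzip2 s]) = j.
  by move: pjb; case: (unzip2 s) => //= x t /andP[]; lia.
by rewrite addnS addSn addnn subnKC.
Qed.

Lemma pairs_of_columns_spec N (B : bargraph) : unimodal_centered_max B ->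
  semiperimeter B = N.+1 -> pairs_of_columns B \in all_pairs N /\
  columns_of_pairs N (pairs_of_columns B) = B.
Proof.
move=> /unimodal_sorted[]; rewrite /semiperimeter e_steps_size n_steps_rises.
have /andP := bargraphP B; move: (columns B) => c [c0 /allP c1].
set k := size c; have kh := odd_double_half k; have ku := uphalf_half k.
pose L := take k./2 c; pose T := drop (uphalf k) c; pose M := take (odd k) (drop k./2 c).
have ME : drop k./2 c = M ++ T.
  by rewrite /M /T ku -drop_drop cat_take_drop.
have cE : c = L ++ M ++ T by rewrite -ME cat_take_drop.
have sM : size M = odd k by rewrite size_take size_drop -/k; case: ifP; lia.
have sL : size L = k./2 by rewrite size_take -/k; case: ifP => //; lia.
have sT : size T = k./2 by rewrite size_drop -/k; lia.
have UE : take (uphalf k) c = L ++ M.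
  by rewrite cE catA take_size_cat// size_cat sL sM ku addnC.
rewrite UE ME => sLM sMT sum.
have posE (t : seq nat) : {subset t <= c} -> [seq h.+1 | h <- [seq h.-1 | h <- t]] = t.
  move=> tc; rewrite -map_comp -[RHS]map_id; apply/eq_in_map => h /tc/c1 /=.
  by move=> h1; rewrite prednK.
have Lc : {subset rev L <= c} by move=> h; rewrite mem_rev => /mem_take.
have Tc : {subset T <= c} by move=> h /mem_drop.
rewrite /pairs_of_columns -/k -/L -/T.
set a := [seq h.-1 | h <- rev L]; set b := [seq h.-1 | h <- T].
have sab : size a = size b by rewrite !size_map size_rev sL sT.
have u1 : unzip1 (zip a b) = a by rewrite unzip1_zip// sab.
have u2 : unzip2 (zip a b) = b by rewrite unzip2_zip// sab.
have ss : size (zip a b) = k./2 by rewrite size_zip sab minnn size_map sT.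
have geq_pred : {homo predn : x y / geq x y} by move=> x y /=; lia.
have sa : sorted geq a.
  apply: (homo_sorted geq_pred); rewrite rev_sorted.
  by move: sLM => /cat_sorted2[].
have sb : sorted geq b.
  by apply: (homo_sorted geq_pred); move: sMT => /cat_sorted2[].
rewrite mem_all_pairs path_geq_pair u1 u2 /columns_of_pairs ss.
set j := N - _.
have E1 : [seq ab.1.+1 | ab <- zip a b] = rev L.
  transitivity [seq x.+1 | x <- unzip1 (zip a b)]; first by rewrite -map_comp.
  by rewrite u1 posE.
have E2 : [seq ab.2.+1 | ab <- zip a b] = T.
  transitivity [seq x.+1 | x <- unzip2 (zip a b)]; first by rewrite -map_comp.
  by rewrite u2 posE.
rewrite E1 E2 revK.
have headz : (head (0, 0) (zip a b)).1 = head 0 a /\ (head (0, 0) (zip a b)).2 = head 0 b.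
  by rewrite -nth0 nth_zip// !nth0.
case: headz => -> ->.
have pathj (t : seq nat) : sorted geq t -> head 0 t <= j -> path geq j t.
  by case: t => //= x t -> ->.
have ha : head 0 a = (last 0 L).-1.
  by rewrite /a; case/lastP: (L) => //= l x; rewrite rev_rcons last_rcons.
have hb : head 0 b = (head 0 T).-1 by rewrite /b; case: (T).
(* With an odd number of columns the central one is the maximum and equals [j]; with an even number
   the larger central height is [j + 1]. *)
case: (odd k) sM kh ku => /= sM kh ku.
  have [x Mx] : exists x, M = [:: x] by move: sM; case: (M) => [|x []]// _; exists x.
  move: sLM sMT sum cE; rewrite Mx => sLM sMT sum cE.
  have x0 : 0 < x by apply: c1; rewrite cE !mem_cat mem_head orbT.
  have hT : head 0 T <= x by move: sMT => /=; case: (T) => //= y t /andP[].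
  have hL : last 0 L <= x.
    move: sLM; rewrite cats1 -rev_sorted rev_rcons /=.
    by case/lastP: (L) => //= l y; rewrite rev_rcons last_rcons /= => /andP[].
  have jx : j = x.
    move: sum; rewrite [in rises _ _]cE catA rises_unimodal//; last first.
      by move: sMT => /path_sorted.
    by rewrite cats1 last_rcons /j; lia.
  rewrite !pathj ?ha ?hb//; [|lia|lia]; split; first by move: jx; rewrite /j; lia.
  by rewrite ifF; [rewrite jx|apply/negbTE; rewrite negb_and; lia].
have M0 : M = [::] by apply/nilP; rewrite /nilp sM.
move: sLM sMT sum cE; rewrite M0 cats0 !cat0s => sLM sMT sum cE.
have jm : (maxn (last 0 L) (head 0 T)) = j.+1 /\ k <= N.
  move: sum; rewrite [in rises _ _]cE rises_unimodal//.
  have : 0 < last 0 L.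
    apply: c1; rewrite cE mem_cat; apply/orP; left.
    by case: (L) sL => [|x l] /= sl; [lia|exact: mem_last].
  by rewrite /j; lia.
rewrite !pathj ?ha ?hb//; [|lia|lia]; split; first lia.
rewrite ifT//; apply/andP; split; first lia.
by apply/eqP; lia.
Qed.

Definition bargraphs_of_pairs (N : nat) : seq bargraph :=
  pmap insub [seq columns_of_pairs N s | s <- all_pairs N].

Lemma uniq_bargraphs_of_pairs N : uniq (bargraphs_of_pairs N).
Proof.
by rewrite pmap_sub_uniq// map_inj_uniq ?uniq_all_pairs//; exact: can_inj (columns_of_pairsK N).
Qed.

Lemma columns_bargraphs_of_pairs N : 0 < N ->
  [seq columns B | B <- bargraphs_of_pairs N] = [seq columns_of_pairs N s | s <- all_pairs N].
Proof.
move=> N0; rewrite /bargraphs_of_pairs; have : {subset all_pairs N <= all_pairs N} by [].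
elim: {1 3 4}(all_pairs N) => //= s l IH sub.
have [v _ _ _] := columns_of_pairs_valid N0 (sub s (mem_head _ _)).
rewrite insubT /= IH// => t tl; apply: sub.
by rewrite in_cons tl orbT.
Qed.

Lemma mem_bargraphs_of_pairs N B : 0 < N ->
  B \in bargraphs_of_pairs N <-> unimodal_of_semiperimeter N.+1 B.
Proof.
move=> N0; rewrite mem_pmap_sub; split=> [/mapP[s sN BE]|[unim sB]].
  have [_ s1 s2 s3] := columns_of_pairs_valid N0 sN.
  split; first by apply/unimodal_sorted; rewrite [columns B]BE.
  by rewrite /= /semiperimeter e_steps_size n_steps_rises [columns B]BE.
have [Bin BE] := pairs_of_columns_spec unim sB.
by apply/mapP; exists (pairs_of_columns B).
Qed.

Lemma degrees_bargraphs_of_pairs N : 0 < N ->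
  [seq degree_of_symmetry B | B <- bargraphs_of_pairs N] =
  [seq coincidences s | s <- all_pairs N].
Proof.
move=> N0.
transitivity [seq coincidences (pairs_of_columns c) |
    c <- [seq columns B | B <- bargraphs_of_pairs N]].
  rewrite -map_comp; apply: eq_map => B /=; apply: degree_of_symmetry_pairs.
  by have /andP[] := bargraphP B.
rewrite columns_bargraphs_of_pairs// -map_comp; apply: eq_map => s /=.
by rewrite columns_of_pairsK.
Qed.

Lemma sum_all_pairs N (F : seq (nat * nat) -> nat) : \sum_(s <- all_pairs N) F s =
  \sum_(m < N.+1 | m.*2 <= N) \sum_(s <- decr_pairs m (N - m.*2) (N - m.*2)) F s.
Proof.
rewrite big_allpairs_dep -[iota _ _]/(index_iota 0 N./2.+1) big_mkord.
pose G m := \sum_(s <- decr_pairs m (N - m.*2) (N - m.*2)) F s.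
have NE := odd_double_half N.
rewrite (big_ord_widen N.+1 G); last lia.
by apply: eq_bigl => m; lia.
Qed.

End Bargraphs.

(** * Moment convergence to the exponential distribution *)

Section ExpTaylor.
Variable R : realType.

(* [(-1) ^+ K] times the Taylor remainder of order [K] of [expR (- y)]. *)
Fixpoint expN_rem (K : nat) (y : R) : R :=
  if K is K'.+1 then y ^+ K' / K'`!%:R - expN_rem K' y else expR (- y).

Lemma is_derive_pow (n : nat) (y : R) :
  is_derive y 1 (fun z : R => z ^+ n.+1) (n.+1%:R * y ^+ n).
Proof.
elim: n => [|n IH].
  by under eq_fun do rewrite expr1; rewrite mulr1; exact: is_derive_id.
have := is_deriveM (is_derive_id y 1) IH.
rewrite (_ : (id * _) = fun z : R => z ^+ n.+2); last first.
  by apply/funext => z; rewrite [RHS]exprS.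
move=> H; apply: (is_derive_eq H).
by rewrite /GRing.scale/= -[n.+2%:R]natr1 [y ^+ n.+1]exprS; ring.
Qed.

Lemma is_derive_expN_rem (K : nat) (y : R) :
  is_derive y 1 (expN_rem K.+1) (expN_rem K y).
Proof.
elim: K => [|K IH].
  have -> : expN_rem 1 = fun z : R => 1 - expR (- z).
    by apply/funext => z; rewrite /= expr0 divr1.
  by apply: is_derive_eq; rewrite /=; ring.
have H : is_derive y 1 (fun z : R => (K.+1`!%:R)^-1 *: z ^+ K.+1) (y ^+ K / K`!%:R).
  have -> : y ^+ K / K`!%:R = (K.+1`!%:R)^-1 *: (K.+1%:R * y ^+ K).
    rewrite /GRing.scale/= factS natrM invfM mulrACA mulVf ?pnatr_eq0// mul1r.
    exact: mulrC.
  exact: is_deriveZ (is_derive_pow K y).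
have := is_deriveB H IH.
congr is_derive; apply/funext => z /=.
by rewrite [RHS]/= [z ^+ K.+1 / _]mulrC.
Qed.

(** Each remainder of positive order vanishes at 0 and has the preceding one as derivative.
    Nonnegativity at order [K.+1] is also the upper bound at order [K]. *)
Lemma expN_rem_ge0 (K : nat) (y : R) : 0 <= y -> 0 <= expN_rem K y.
Proof.
elim: K y => [|K IH] y y0; first exact: expR_ge0.
have rem0 : expN_rem K.+1 0 = 0.
  elim: K {IH} => [|K IH]; first by rewrite /= expr0 divr1 oppr0 expR0 subrr.
  by rewrite [LHS]/= -/(expN_rem K.+1 0) IH expr0n/= mul0r subrr.
rewrite -rem0; apply: (@ger0_derive1_ndecry _ _ 0) => //.
- by move=> x _; have [] := is_derive_expN_rem K x.
- move=> x; rewrite in_itv/= andbT => x0; rewrite derive1E.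
  by have [_ ->] := is_derive_expN_rem K x; apply: IH; exact: ltW.
- apply: continuous_subspaceT => x.
  have [+ _] := is_derive_expN_rem K x.
  by move=> /derivable1_diffP/differentiable_continuous.
Qed.

Lemma expN_rem_le (K : nat) (y : R) : 0 <= y -> expN_rem K y <= y ^+ K / K`!%:R.
Proof. by move=> /(expN_rem_ge0 K.+1); rewrite /= subr_ge0. Qed.

Lemma expN_taylor (K : nat) (y : R) :
  expR (- y) - \sum_(l < K) (- y) ^+ l / l`!%:R = (-1) ^+ K * expN_rem K y.
Proof.
elim: K => [|K IH]; first by rewrite big_ord0 subr0 mul1r.
rewrite big_ord_recr/= opprD addrA IH exprS mulrBr (exprNn y).
by ring.
Qed.

Lemma expN_taylor_le (K : nat) (y : R) : 0 <= y ->
  `|expR (- y) - \sum_(l < K) (- y) ^+ l / l`!%:R| <= y ^+ K / K`!%:R.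
Proof.
move=> y0; rewrite expN_taylor normrM normrX normrN1 expr1n mul1r.
by rewrite ger0_norm ?expN_rem_ge0// expN_rem_le.
Qed.

End ExpTaylor.

Section NegativeBinomialSeries.
Variable R : realType.

Let geo (x : R) : fps R := fun n => x ^+ n.

Let geoX x k l : (geo x ^+ k.+1) l = 'C(k + l, l)%:R * x ^+ l.
Proof.
elim: k l => [|k IH] l; first by rewrite expr1 add0n binn mul1r.
rewrite exprSr fpsM (eq_bigr (fun i : 'I_l.+1 => 'C(k + i, i)%:R * x ^+ l)).
  rewrite -mulr_suml -natr_sum; congr (_%:R * _).
  elim: l => [|l IHl]; first by rewrite big_ord1 !bin0.
  by rewrite big_ord_recr/= IHl [in RHS]addnS binS addSnnS addnC.
move=> i _; rewrite IH /geo -mulrA -exprD subnKC//.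
by rewrite -ltnS.
Qed.

Let fast_geo x : `|x| < 1 -> fps_fast (geo x) /\ fps_sum (geo x) = (1 - x)^-1.
Proof.
move=> x1; split; last first.
  apply/cvg_lim => //; rewrite -[X in _ --> X]mul1r.
  rewrite (_ : series _ = series (geometric 1 x)); first exact: cvg_geometric_series.
  by congr series; apply/funext => n; rewrite /geometric/= mul1r.
have [C HC] : fps_fast (fps_scale `|x| (fun=> 1 : R)).
  by apply: fps_fast_scale => [|n]; rewrite ?normr_ge0// normr1.
exists C => n; apply: le_trans (HC n); rewrite le_eqVlt; apply/orP; left; apply/eqP.
by apply: eq_bigr => k _; rewrite /geo /fps_scale mulr1 !normrX normr_id.
Qed.

(** The coefficients are those of the power [k.+1] of the geometric series, which is fast, so
    [fps_sum] commutes with the power. *)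
Lemma cvg_neg_binomial_series (x : R) k : `|x| < 1 ->
  \sum_(l < K) 'C(k + l, l)%:R * x ^+ l @[K --> \oo] --> (1 - x) ^- k.+1.
Proof.
move=> /fast_geo[f s]; have [fk sk] := fps_fastX k.+1 f.
rewrite -exprVn -s -sk.
rewrite (_ : (fun K => _) = series (geo x ^+ k.+1)); first exact: fps_fast_cvg.
by apply/funext => K; rewrite /series/= big_mkord; apply: eq_bigr => l _; rewrite geoX.
Qed.

Lemma cvg_neg_binomial_coef (x : R) k : `|x| < 1 ->
  'C(k + l, l)%:R * x ^+ l @[l --> \oo] --> (0 : R).
Proof.
move=> /fast_geo[f s]; have [fk sk] := fps_fastX k.+1 f.
have := cvg_series_cvg_0 (fps_fast_cvg fk).
by rewrite (_ : geo x ^+ k.+1 = fun l => 'C(k + l, l)%:R * x ^+ l)//; apply/funext => l.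
Qed.

End NegativeBinomialSeries.

(** Exchange of limits without uniformity: the error has to vanish only when [n] goes to infinity
    first and [K] afterwards. *)
Lemma cvgn_approx (R : realType) (A : nat -> R) (S e : nat -> nat -> R)
    (T E : nat -> R) (t : R) :
  (forall K n, `|A n - S K n| <= e K n) ->
  (forall K, S K n @[n --> \oo] --> T K) ->
  (forall K, e K n @[n --> \oo] --> E K) ->
  T K @[K --> \oo] --> t -> E K @[K --> \oo] --> (0 : R) ->
  A n @[n --> \oo] --> t.
Proof.
move=> AS ST eE Tt E0; apply/cvgrPdist_lt => d d0.
have d4 : 0 < d / 4 by rewrite divr_gt0.
have [K [TK EK]] : exists K, `|t - T K| < d / 4 /\ E K < d / 4.
  have /cvgrPdist_lt/(_ _ d4) H1 := Tt; have H2 := cvgr_lt _ E0 _ d4.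
  by near \oo => K; exists K; split; near: K; [exact: H1|exact: H2].
have /cvgrPdist_lt/(_ _ d4) H1 := ST K.
have EK2 : E K < d / 4 by [].
have H2 := cvgr_lt _ (eE K) _ EK2.
near=> n.
have h1 : `|T K - S K n| < d / 4 by near: n; exact: H1.
have h2 : e K n < d / 4 by near: n; exact: H2.
have h3 := AS K n.
have -> : t - A n = (t - T K) + (T K - S K n) - (A n - S K n) by ring.
apply: (le_lt_trans (ler_normB _ _)).
have := ler_normD (t - T K) (T K - S K n); lra.
Unshelve. all: by end_near. Qed.

Section Average.
Variable R : realType.
Implicit Types (s : seq R) (f g : R -> R).

(** Expectation for the uniform law on a list with repetitions. The limit argument runs on lists;
    measures return only with the distribution function. *)
Definition average s f : R := (\sum_(x <- s) f x) / (size s)%:R.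

Lemma averageD s f g : average s (fun x => f x + g x) = average s f + average s g.
Proof. by rewrite /average big_split/= mulrDl. Qed.

Lemma averageB s f g : average s (fun x => f x - g x) = average s f - average s g.
Proof. by rewrite /average sumrB mulrBl. Qed.

Lemma averageZ s c f : average s (fun x => c * f x) = c * average s f.
Proof. by rewrite /average -mulr_sumr mulrA. Qed.

Lemma average_sum s I (r : seq I) (F : I -> R -> R) :
  average s (fun x => \sum_(i <- r) F i x) = \sum_(i <- r) average s (F i).
Proof. by rewrite /average exchange_big/= mulr_suml. Qed.

Lemma eq_average s f g : {in s, f =1 g} -> average s f = average s g.
Proof. by move=> fg; rewrite /average; congr (_ / _); apply: eq_big_seq. Qed.

Lemma le_average s f g : {in s, forall x, f x <= g x} -> average s f <= average s g.
Proof.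
move=> fg; rewrite /average; apply: ler_wpM2r; first by rewrite invr_ge0.
by rewrite big_seq [leRHS]big_seq; apply: ler_sum.
Qed.

Lemma norm_average s f : `|average s f| <= average s (fun x => `|f x|).
Proof.
rewrite /average normrM [X in _ * X]ger0_norm ?invr_ge0//.
by apply: ler_wpM2r; rewrite ?invr_ge0// ler_norm_sum.
Qed.

End Average.

Section ExponentialLimit.
Variables (R : realType) (s : nat -> seq R).
Hypothesis s_ge0 : forall n x, x \in s n -> 0 <= x.
Hypothesis moments : forall k,
  average (s n) (fun x => x ^+ k) @[n --> \oo] --> (k`!%:R : R).

(** One more factor [exp(- x / 2)] is expanded by Taylor and integrated with the limits known for
    [i]. With [a = 1 + i / 2] this gives a negative binomial series in [- 1 / (2 a)], convergent as
    [a >= 1]. A full step [exp(- x)] would have ratio of modulus 1 at [i = 0]. *)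
Let tilted i k : average (s n) (fun x => x ^+ k * expR (- (x / 2)) ^+ i) @[n --> \oo]
  --> (k`!%:R / (1 + i%:R / 2) ^+ k.+1 : R).
Proof.
elim: i k => [|i IH] k.
  rewrite mul0r addr0 expr1n divr1.
  rewrite (_ : (fun n => _) = (fun n => average (s n) (fun x => x ^+ k))) //.
  by apply/funext => n; apply: eq_average => x _; rewrite expr0 mulr1.
pose a : R := 1 + i%:R / 2.
have a1 : 1 <= a by rewrite lerDl divr_ge0.
have a0 : 0 < a by apply: lt_le_trans a1.
pose m l n := average (s n) (fun x => x ^+ (k + l) * expR (- (x / 2)) ^+ i).
have ml l : m l n @[n --> \oo] --> (k + l)`!%:R / a ^+ (k + l).+1 by exact: IH.
have factE l : (k + l)`!%:R / a ^+ (k + l).+1 / 2 ^+ l / l`!%:R =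
    k`!%:R / a ^+ k.+1 * ('C(k + l, l)%:R * (2 * a)^-1 ^+ l) :> R.
  have := bin_fact (leq_addl k l); rewrite addnK => <-; rewrite !natrM.
  rewrite -addSn exprD exprVn exprMn.
  have a0' := lt0r_neq0 a0; have l0 : l`!%:R != 0 :> R by rewrite pnatr_eq0 -lt0n fact_gt0.
  have e1 : a ^+ k.+1 != 0 by rewrite expf_neq0.
  have e2 : a ^+ l != 0 by rewrite expf_neq0.
  have e3 : 2 ^+ l != 0 :> R by rewrite expf_neq0// pnatr_eq0.
  move: l0 e1 e2 e3; move: (l`!%:R : R) (a ^+ k.+1) (a ^+ l) (2 ^+ l : R) => *.
  by field; apply/and4P; split.
have x1 : `|(2 * a)^-1| < 1.
  rewrite gtr0_norm ?invr_gt0 ?mulr_gt0// invf_lt1 ?mulr_gt0//; lra.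
apply: (@cvgn_approx _ _
  (fun K n => \sum_(l < K) ((- 1) ^+ l / 2 ^+ l / l`!%:R) * m l n)
  (fun K n => (2 ^+ K)^-1 / K`!%:R * m K n)
  (fun K => k`!%:R / a ^+ k.+1 * \sum_(l < K) 'C(k + l, l)%:R * (- (2 * a)^-1) ^+ l)
  (fun K => k`!%:R / a ^+ k.+1 * ('C(k + K, K)%:R * (2 * a)^-1 ^+ K))).
- move=> K n; rewrite /m.
  rewrite -averageZ.
  have -> : \sum_(l < K) (- 1) ^+ l / 2 ^+ l / l`!%:R *
      average (s n) (fun x => x ^+ (k + l) * expR (- (x / 2)) ^+ i) =
      average (s n) (fun x => \sum_(l < K) (- 1) ^+ l / 2 ^+ l / l`!%:R *
        (x ^+ (k + l) * expR (- (x / 2)) ^+ i)).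
    by rewrite average_sum; apply: eq_bigr => l _; rewrite averageZ.
  rewrite -averageB.
  apply: (le_trans (norm_average _ _)); apply: le_average => x /s_ge0 x0.
  have -> : x ^+ k * expR (- (x / 2)) ^+ i.+1 -
      \sum_(l < K) (- 1) ^+ l / 2 ^+ l / l`!%:R * (x ^+ (k + l) * expR (- (x / 2)) ^+ i) =
      x ^+ k * expR (- (x / 2)) ^+ i *
      (expR (- (x / 2)) - \sum_(l < K) (- (x / 2)) ^+ l / l`!%:R).
    rewrite mulrBr mulr_sumr exprSr mulrA; congr (_ - _).
    apply: eq_bigr => l _; rewrite exprD -[- (x / 2)]mulN1r !exprMn exprVn mulN1r; ring.
  have xe0 : 0 <= x ^+ k * expR (- (x / 2)) ^+ i.
    by rewrite mulr_ge0 ?exprn_ge0// expR_ge0.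
  rewrite normrM (ger0_norm xe0).
  have x20 : 0 <= x / 2 by rewrite divr_ge0.
  apply: (le_trans (ler_wpM2l xe0 (expN_taylor_le K x20))).
  by rewrite exprD exprMn exprVn le_eqVlt; apply/orP; left; apply/eqP; ring.
- move=> K; rewrite mulr_sumr.
  apply: (@cvgn_sum _ _ _ (fun (l : 'I_K) n => (- 1) ^+ l / 2 ^+ l / l`!%:R * m l n)) => l.
  rewrite [X in _ --> X](_ : _ = (- 1) ^+ l / 2 ^+ l / l`!%:R *
      ((k + l)`!%:R / a ^+ (k + l).+1)); first exact: cvgMr.
  transitivity ((- 1) ^+ l * (k`!%:R / a ^+ k.+1 * ('C(k + l, l)%:R * (2 * a)^-1 ^+ l))).
    by rewrite (exprNn (2 * a)^-1); ring.
  by rewrite -factE; ring.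
- move=> K; rewrite -factE.
  rewrite [X in _ --> X](_ : _ = (2 ^+ K)^-1 / K`!%:R *
    ((k + K)`!%:R / a ^+ (k + K).+1)); last by ring.
  exact: cvgMr.
(* The sum of the series contributes [1 + 1 / (2 a)], and [a (1 + 1 / (2 a)) = a + 1 / 2] is the
   parameter of the next tilt. *)
- have -> : 1 + i.+1%:R / 2 = a + 1 / 2 by rewrite /a -[i.+1%:R]natr1; ring.
  have -> : k`!%:R / (a + 1 / 2) ^+ k.+1 =
      k`!%:R / a ^+ k.+1 * (1 - - (2 * a)^-1) ^- k.+1.
    rewrite -mulrA -invfM -exprMn; congr (_ / _ ^+ _).
    by field; rewrite lt0r_neq0.
  by apply: cvgMr; apply: cvg_neg_binomial_series; rewrite normrN.
- rewrite -[X in _ --> X](mulr0 (k`!%:R / a ^+ k.+1)).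
  by apply: cvgMr; exact: cvg_neg_binomial_coef.
Qed.

Let uniform_moment j : average (s n) (fun x => expR (- x) ^+ j) @[n --> \oo]
  --> (j.+1%:R^-1 : R).
Proof.
have := @tilted j.*2 0; rewrite fact0 expr1 mul1r.
have -> : 1 + (j.*2)%:R / 2 = j.+1%:R :> R.
  by rewrite -[in RHS]natr1 addrC -muln2 natrM mulfK.
rewrite (_ : (fun n => _) = (fun n => average (s n) (fun x => expR (- x) ^+ j))) //.
apply/funext => n; apply: eq_average => x _; rewrite expr0 mul1r -mul2n exprM.
by rewrite expr2 -expRD; congr (expR _ ^+ _); field.
Qed.

(** The limits are the Beta integrals of [u^j (1 - u)^l] over the unit interval. *)
Let beta_moment j l :
  average (s n) (fun x => expR (- x) ^+ j * (1 - expR (- x)) ^+ l) @[n --> \oo]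
  --> (j`!%:R * l`!%:R / (j + l).+1`!%:R : R).
Proof.
elim: l j => [|l IH] j.
  rewrite addn0 mulr1 factS natrM invfM mulrCA mulfV ?mulr1; last first.
    by rewrite pnatr_eq0 -lt0n fact_gt0.
  rewrite (_ : (fun n => _) = (fun n => average (s n) (fun x => expR (- x) ^+ j))) //.
  by apply/funext => n; apply: eq_average => x _; rewrite expr0 mulr1.
rewrite (_ : (fun n => _) = (fun n =>
    average (s n) (fun x => expR (- x) ^+ j * (1 - expR (- x)) ^+ l) -
    average (s n) (fun x => expR (- x) ^+ j.+1 * (1 - expR (- x)) ^+ l))); last first.
  by apply/funext => n; rewrite -averageB; apply: eq_average => x _; rewrite !exprS; ring.
rewrite [X in _ --> X](_ : _ = j`!%:R * l`!%:R / (j + l).+1`!%:R -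
    j.+1`!%:R * l`!%:R / (j.+1 + l).+1`!%:R); first exact: cvgB.
have f0 : (j + l).+1`!%:R != 0 :> R by rewrite pnatr_eq0 -lt0n fact_gt0.
have n0 : (j + l).+2%:R != 0 :> R by rewrite pnatr_eq0.
have F p : p.+1`!%:R = p.+1%:R * p`!%:R :> R by rewrite factS natrM.
rewrite addnS addSn (F (j + l).+1) (F l) (F j).
have E : (j + l).+2%:R = j.+1%:R + l.+1%:R :> R by rewrite -natrD addSn addnS.
move: f0 n0; rewrite E.
move: (j`!%:R : R) (l`!%:R : R) ((j + l).+1`!%:R : R) (j.+1%:R : R) (l.+1%:R : R).
by move=> a b f x y f0 n0; field; rewrite f0 n0.
Qed.

(** The mean of [g] at a binomial variable of parameters [K], [c]. The nodes are the integers [j]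
    rather than [j / K]. *)
Definition bernstein (K : nat) (g : nat -> R) (c : R) : R :=
  \sum_(j < K.+1) 'C(K, j)%:R * (c ^+ j * (1 - c) ^+ (K - j)) * g j.

(** Under the uniform law every Bernstein basis polynomial of degree [K] has mean [1 / (K + 1)]. *)
Lemma cvg_average_bernstein K g : average (s n) (fun x => bernstein K g (expR (- x))) @[n --> \oo]
  --> ((\sum_(j < K.+1) g j) / K.+1%:R : R).
Proof.
rewrite (_ : (fun n => _) = (fun n => \sum_(j < K.+1) ('C(K, j)%:R * g j) *
    average (s n) (fun x => expR (- x) ^+ j * (1 - expR (- x)) ^+ (K - j)))); last first.
  apply/funext => n; rewrite /bernstein average_sum; apply: eq_bigr => j _.
  by rewrite -averageZ; apply: eq_average => x _; ring.
rewrite mulr_suml.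
apply: (@cvgn_sum _ _ _ (fun (j : 'I_K.+1) n => ('C(K, j)%:R * g j) *
    average (s n) (fun x => expR (- x) ^+ j * (1 - expR (- x)) ^+ (K - j)))) => j.
have jK : (j <= K)%N by rewrite -ltnS.
rewrite [X in _ --> X](_ : _ = ('C(K, j)%:R * g j) *
    (j`!%:R * (K - j)`!%:R / (j + (K - j)).+1`!%:R)); first exact: cvgMr.
rewrite subnKC// factS natrM -(bin_fact jK) (natrM _ 'C(K, j)) (natrM _ j`!).
have f0 : j`!%:R != 0 :> R by rewrite pnatr_eq0 -lt0n fact_gt0.
have f1 : (K - j)`!%:R != 0 :> R by rewrite pnatr_eq0 -lt0n fact_gt0.
have f2 : 'C(K, j)%:R != 0 :> R by rewrite pnatr_eq0 -lt0n bin_gt0.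
have n0 : K.+1%:R != 0 :> R by rewrite pnatr_eq0.
move: f0 f1 f2 n0.
move: (j`!%:R : R) ((K - j)`!%:R : R) ('C(K, j)%:R : R) (K.+1%:R : R) => *.
by field; apply/and4P; split.
Qed.

End ExponentialLimit.

Section Bernstein.
Variable R : realType.
Implicit Types (g : nat -> R) (c : R).

(** Conditioning the binomial variable on one of its trials. *)
Lemma bernsteinS K g c :
  bernstein K.+1 g c = (1 - c) * bernstein K g c + c * bernstein K (g \o S) c.
Proof.
rewrite /bernstein big_ord_recl/= [in RHS]big_ord_recl/=.
rewrite (eq_bigr (fun i : 'I_K.+1 => c * ('C(K, i)%:R * (c ^+ i * (1 - c) ^+ (K - i)) * g i.+1) +
   'C(K, i.+1)%:R * (c ^+ i.+1 * (1 - c) ^+ (K - i)) * g i.+1)); last first.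
  by move=> i _; rewrite /bump/= add1n subSS binS natrD exprS; ring.
rewrite big_split/= -mulr_sumr addrA addrAC; congr (_ + _).
rewrite mulrDr; congr (_ + _).
  by rewrite !bin0 !subn0 !expr0 (exprS (1 - c)); ring.
rewrite big_ord_recr/= bin_small// !mul0r addr0 mulr_sumr; apply: eq_bigr => i _.
rewrite /bump/= add1n.
have -> : (K - i = (K - i.+1).+1)%N by have := ltn_ord i; lia.
by rewrite (exprS (1 - c)); ring.
Qed.

Lemma eq_bernstein K g1 g2 c : g1 =1 g2 -> bernstein K g1 c = bernstein K g2 c.
Proof. by move=> E; apply: eq_bigr => i _; rewrite E. Qed.

(** The centre [a] is arbitrary because the induction moves it to [a - 1]; at [a = K c] only the
    variance is left. *)
Lemma bernstein_var K (a c : R) :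
  bernstein K (fun j => (j%:R - a) ^+ 2) c = K%:R * c * (1 - c) + (K%:R * c - a) ^+ 2.
Proof.
elim: K a => [|K IH] a.
  by rewrite /bernstein big_ord1 bin0 subn0 !expr0/=; ring.
rewrite bernsteinS IH (@eq_bernstein _ _ (fun j => (j%:R - (a - 1)) ^+ 2)).
  by rewrite IH -[K.+1%:R]natr1; ring.
by move=> j /=; rewrite -natr1; ring.
Qed.

Lemma bernstein_cst K c : bernstein K (fun=> 1) c = 1.
Proof.
elim: K => [|K IH]; first by rewrite /bernstein big_ord1 bin0 subn0 !expr0 !mul1r.
by rewrite bernsteinS IH; ring.
Qed.

Lemma bernsteinZ K k g c : bernstein K (fun j => k * g j) c = k * bernstein K g c.
Proof. by rewrite /bernstein mulr_sumr; apply: eq_bigr => i _; ring. Qed.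

Lemma bernsteinD K g1 g2 c :
  bernstein K (fun j => g1 j + g2 j) c = bernstein K g1 c + bernstein K g2 c.
Proof. by rewrite /bernstein -big_split; apply: eq_bigr => i _; rewrite mulrDr. Qed.

Lemma le_bernstein K g1 g2 c : 0 <= c <= 1 -> (forall j, g1 j <= g2 j) ->
  bernstein K g1 c <= bernstein K g2 c.
Proof.
move=> /andP[c0 c1] g12; apply: ler_sum => i _; apply: ler_wpM2l => //.
by rewrite mulr_ge0// mulr_ge0// exprn_ge0// subr_ge0.
Qed.

(* Chebyshev's inequality for the binomial distribution of parameters [K], [c]. *)
Lemma bernstein_chebyshev K g (c d : R) : 0 <= c <= 1 -> 0 < d -> (0 < K)%N ->
  (forall j, g j * (K%:R * d) ^+ 2 <= (j%:R - K%:R * c) ^+ 2) ->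
  bernstein K g c <= (K%:R * d ^+ 2)^-1.
Proof.
move=> c01 d0 K0 gle; have /andP[c0 c1] := c01.
have k0 : 0 < K%:R :> R by rewrite ltr0n.
have p0 : 0 < (K%:R * d) ^+ 2 by rewrite exprn_gt0// mulr_gt0.
have H : (K%:R * d) ^+ 2 * bernstein K g c <= K%:R.
  rewrite -bernsteinZ.
  apply: (@le_trans _ _ (bernstein K (fun j => (j%:R - K%:R * c) ^+ 2) c)).
    by apply: le_bernstein => // j; rewrite mulrC.
  rewrite bernstein_var subrr expr0n addr0 -mulrA ler_piMr// ?ltW//.
  nra.
rewrite -(ler_pM2l p0); apply: (le_trans H).
rewrite le_eqVlt; apply/orP; left; apply/eqP; field.
by rewrite !lt0r_neq0.
Qed.

End Bernstein.

Section ThresholdCount.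
Variable R : realType.
Implicit Types (w : R) (K : nat).

Lemma threshold_count_le w K : w <= K%:R -> \sum_(j < K) ((w <= j%:R)%R)%:R <= K%:R - w.
Proof.
suff : \sum_(j < K) ((w <= j%:R)%R)%:R <= Num.max 0 (K%:R - w).
  by move=> H wK; apply: (le_trans H); rewrite ge_max lexx subr_ge0 wK.
elim: K => [|K IH]; first by rewrite big_ord0 le_max lexx.
rewrite big_ord_recr/= -natr1; case: (leP w K%:R) => wK.
  by move: IH; rewrite /= !le_max => /orP[|] IH; apply/orP; right; lra.
by rewrite addr0; apply: (le_trans IH); rewrite ge_max !le_max lexx/=; apply/orP; right; lra.
Qed.

Lemma threshold_count_ge w K : 0 <= w -> K%:R - 1 - w <= \sum_(j < K) ((w <= j%:R)%R)%:R.
Proof.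
move=> w0; elim: K => [|K IH]; first by rewrite big_ord0; lra.
rewrite big_ord_recr/= -natr1; case: (leP w K%:R) => wK; first by rewrite /=; lra.
apply: (@le_trans _ _ 0); first lra.
by rewrite addr0 sumr_ge0.
Qed.

End ThresholdCount.

Lemma cvg_dist_harmonic (R : realType) (u : nat -> R) (l k : R) :
  (forall n, `|l - u n| <= k * harmonic n) -> u n @[n --> \oo] --> l.
Proof.
move=> H; apply/cvgrPdist_le => e e0.
have : k * harmonic n @[n --> \oo] --> (0 : R).
  by rewrite -[X in _ --> X](mulr0 k); apply: cvgMr; exact: cvg_harmonic.
move=> /cvgr_le/(_ _ e0) le_e; near=> n; apply: (le_trans (H n)).
by near: n.
Unshelve. all: by end_near. Qed.

Theorem exponential_limit (R : realType) (s : nat -> seq R) :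
  (forall n x, x \in s n -> 0 <= x) ->
  (forall k, average (s n) (fun x => x ^+ k) @[n --> \oo] --> (k`!%:R : R)) ->
  forall y, 0 <= y ->
  average (s n) (fun x => (x <= y)%R%:R) @[n --> \oo] --> 1 - expR (- y).
Proof.
move=> s_ge0 moments y y0.
set v := expR (- y).
have v0 : 0 < v by exact: expR_gt0.
have v1 : v <= 1 by rewrite /v -expR0 ler_expR oppr_le0.
pose d m : R := harmonic m.
have d0 m : 0 < d m by rewrite /d /harmonic/= invr_gt0.
(* The cube makes the Chebyshev error [1 / (K d^2)] equal to the smoothing width [d] itself. *)
pose K m := (m.+1 ^ 3)%N.
have KE m : (K m)%:R * d m ^+ 2 = m.+1%:R.
  have m0 : m.+1%:R != 0 :> R by rewrite pnatr_eq0.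
  by rewrite /K natrX /d /harmonic/= exprVn exprSr mulrAC mulfV ?mul1r// expf_neq0.
have K1 m : (m.+1 <= K m)%N by rewrite /K -[X in (X <= _)%N]expn1 leq_pexp2l.
have K0 m : (0 < K m)%N by apply: leq_trans (K1 m).
(* The event [x <= y] reads [exp(- x) >= v]. Moving the jump by [d] on either side keeps the
   binomial mean at distance at least [K d] from it where a one-sided bound is needed, so Chebyshev
   gives [B hi - d <= A <= B lo + d]. *)
pose lo m j : R := (((v - d m) * (K m)%:R <= j%:R)%R)%:R.
pose hi m j : R := (((v + d m) * (K m)%:R <= j%:R)%R)%:R.
pose B g m n := average (s n) (fun x => bernstein (K m) (g m) (expR (- x))).
pose r (g : nat -> nat -> R) m : R := (\sum_(j < (K m).+1) g m j) / (K m).+1%:R.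
have BE g m : B g m n @[n --> \oo] --> r g m by exact: cvg_average_bernstein.
have one : average (s n) (fun=> 1) @[n --> \oo] --> (1 : R).
  have := moments 0%N; rewrite fact0.
  by under eq_fun do under [X in average _ X]eq_fun do rewrite expr0.
pose A n := average (s n) (fun x => (x <= y)%R%:R).
have c01 n (x : R) : x \in s n -> 0 <= expR (- x) <= 1.
  by move=> /s_ge0 x0; rewrite expR_ge0 -expR0 ler_expR oppr_le0.
have bern01 m (g : nat -> R) (c : R) : 0 <= c <= 1 ->
    (forall j, 0 <= g j <= 1) -> 0 <= bernstein m g c <= 1.
  move=> c01' g01; rewrite -(bernstein_cst m c).
  apply/andP; split; last by apply: le_bernstein => // j; have /andP[] := g01 j.
  rewrite -[X in X <= _](mul0r (bernstein m (fun=> 1) c)) -bernsteinZ.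
  by apply: le_bernstein => // j; rewrite mul0r; have /andP[] := g01 j.
have b01 (b : bool) : 0 <= (b%:R : R) <= 1 by case: b; rewrite lexx ler01.
have up m n : A n <= B lo m n + d m * average (s n) (fun=> 1).
  rewrite -averageZ -averageD; apply: le_average => x xs; rewrite mulr1.
  have cc := c01 n x xs.
  case: (leP x y) => xy; last first.
    apply: addr_ge0; last exact: ltW.
    by have /andP[] := bern01 (K m) (lo m) _ cc (fun j => b01 _).
  rewrite -(bernstein_cst (K m) (expR (- x))).
  rewrite (@eq_bernstein _ _ _ (fun j => lo m j + (1 - lo m j))); last first.
    by move=> j; rewrite addrC subrK.
  rewrite bernsteinD lerD2l.
  have -> : d m = ((K m)%:R * d m ^+ 2)^-1 by rewrite KE.
  apply: bernstein_chebyshev => // j; rewrite /lo; case: (leP ((v - d m) * (K m)%:R) j%:R) => h.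
    by rewrite /= subrr mul0r sqr_ge0.
  have vx : v <= expR (- x) by rewrite /v ler_expR lerN2.
  rewrite /= subr0 mul1r -[X in _ <= X]sqrrN ler_pXn2r ?nnegrE//.
  - have : v * (K m)%:R <= expR (- x) * (K m)%:R by exact: ler_wpM2r.
    by lra.
  - by rewrite mulr_ge0// ltW.
  - have : v * (K m)%:R <= expR (- x) * (K m)%:R by exact: ler_wpM2r.
    have : 0 <= d m * (K m)%:R by rewrite mulr_ge0// ltW.
    by lra.
have dn m n : B hi m n - d m * average (s n) (fun=> 1) <= A n.
  rewrite lerBlDr -averageZ -averageD; apply: le_average => x xs; rewrite mulr1.
  have cc := c01 n x xs.
  case: (leP x y) => xy.
    apply: (@le_trans _ _ 1); last by rewrite lerDl ltW.
    by have /andP[] := bern01 (K m) (hi m) _ cc (fun j => b01 _).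
  rewrite add0r.
  have -> : d m = ((K m)%:R * d m ^+ 2)^-1 by rewrite KE.
  apply: bernstein_chebyshev => // j; rewrite /hi.
  case: (leP ((v + d m) * (K m)%:R) j%:R) => h; last first.
    by rewrite /= mul0r sqr_ge0.
  have vx : expR (- x) <= v by rewrite /v ler_expR lerN2 ltW.
  rewrite /= mul1r ler_pXn2r ?nnegrE//.
  - have : expR (- x) * (K m)%:R <= v * (K m)%:R by exact: ler_wpM2r.
    by lra.
  - by rewrite mulr_ge0// ltW.
  - have : expR (- x) * (K m)%:R <= v * (K m)%:R by exact: ler_wpM2r.
    have : 0 <= d m * (K m)%:R by rewrite mulr_ge0// ltW.
    by lra.
have hilo m : r hi m <= r lo m.
  rewrite /r ler_pM2r ?invr_gt0//; apply: ler_sum => j _; rewrite /hi /lo ler_nat.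
  case: (leP ((v + d m) * (K m)%:R) j%:R) => // h.
  case: (leP ((v - d m) * (K m)%:R) j%:R) => // h'.
  have : 0 <= d m * (K m)%:R by rewrite mulr_ge0// ltW.
  by lra.
have dK m : (K m).+1%:R^-1 <= d m.
  by rewrite /d /harmonic/= lef_pV2 ?posrE// ler_nat leqW.
have k0 m : 0 < (K m).+1%:R :> R by [].
have lo_le m : r lo m <= 1 - v + 2 * d m.
  apply: (@le_trans _ _ (1 - v + d m + (K m).+1%:R^-1)); last first.
    by have := dK m; move: (_.+1%:R^-1) => z; lra.
  rewrite /r ler_pdivrMr// mulrDl mulVf ?gt_eqF//.
  have kd : 0 <= d m * (K m).+1%:R by rewrite mulr_ge0// ltW.
  have kd' : 0 <= v * (K m)%:R by rewrite mulr_ge0// ltW.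
  apply: (le_trans (threshold_count_le _)).
    rewrite -natr1; have : v * (K m)%:R <= (K m)%:R by rewrite ler_piMl.
    have : 0 <= d m * (K m)%:R by rewrite mulr_ge0// ltW.
    by have : 0 <= (K m)%:R :> R by []; lra.
  rewrite -natr1 in kd *; have := d0 m; lra.
have hi_ge m : 1 - v - 2 * d m <= r hi m.
  apply: (@le_trans _ _ (1 - v - d m - (K m).+1%:R^-1)).
    by have := dK m; move: (_.+1%:R^-1) => z; lra.
  rewrite /r ler_pdivlMr// mulrBl mulVf ?gt_eqF//.
  apply: le_trans (threshold_count_ge _ _).
    rewrite -natr1; have := d0 m; lra.
  by rewrite mulr_ge0// addr_ge0// ltW.
have lol : r lo m @[m --> \oo] --> 1 - v.
  apply: (@cvg_dist_harmonic _ _ _ 2) => m; rewrite -/(d m) ler_norml.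
  by have := lo_le m; have := hi_ge m; have := hilo m; move=> *; apply/andP; split; lra.
have hil : r hi m @[m --> \oo] --> 1 - v.
  apply: (@cvg_dist_harmonic _ _ _ 2) => m; rewrite -/(d m) ler_norml.
  by have := lo_le m; have := hi_ge m; have := hilo m; move=> *; apply/andP; split; lra.
(* The midpoint of the two bounds is the approximation; half their gap plus [d] is the error. *)
apply: (@cvgn_approx _ A (fun m n => (B lo m n + B hi m n) / 2)
  (fun m n => (B lo m n - B hi m n) / 2 + d m * average (s n) (fun=> 1))
  (fun m => (r lo m + r hi m) / 2)
  (fun m => (r lo m - r hi m) / 2 + d m * 1)).
- move=> m n; rewrite ler_norml; have := up m n; have := dn m n.
  by move=> *; apply/andP; split; lra.
- by move=> m; apply: cvgMl; apply: cvgD.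
- by move=> m; apply: cvgD; [apply: cvgMl; apply: cvgB|apply: cvgMr].
- rewrite [X in _ --> X](_ : _ = (1 - v + (1 - v)) / 2); last by field.
  by apply: cvgMl; apply: cvgD.
- rewrite [X in _ --> X](_ : _ = (1 - v - (1 - v)) / 2 + 0); last by field.
  apply: cvgD; first by apply: cvgMl; apply: cvgB.
  by under eq_fun do rewrite mulr1; exact: cvg_harmonic.
Qed.

Section RayleighCdf.
Variables (R : realType) (s : R).
Hypothesis s0 : s != 0.
Let f (x : R) : R := x / s ^+ 2 * expR (- x ^+ 2 / (2 * s ^+ 2)).
Let F (x : R) : R := - expR (- x ^+ 2 / (2 * s ^+ 2)).

Let is_deriveF (x : R) : is_derive x 1 F (f x).
Proof.
have H : is_derive x 1 (fun y : R => - y ^+ 2 / (2 * s ^+ 2)) (- (x / s ^+ 2)).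
  apply: is_derive_eq; rewrite scaler0 add0r /GRing.scale/=.
  by field.
by apply: is_derive_eq; rewrite mulrN opprK mulrC.
Qed.

Let continuousF : continuous F.
Proof. by move=> x; have [/derivable1_diffP/differentiable_continuous] := is_deriveF x. Qed.

Let continuousf : continuous f.
Proof.
move=> x; apply: cvgM; first by apply: cvgM; [exact: cvg_id|exact: cvg_cst].
apply: continuous_comp; last exact: continuous_expR.
apply: cvgM; last exact: cvg_cst.
by apply: cvgN; exact: exprn_continuous.
Qed.

Lemma rayleigh_cdf_lt0 (x : R) : x < 0 -> rayleigh_prob s `]-oo, x] = 0%E.
Proof.
move=> x0; rewrite /rayleigh_prob integral0_eq// => y /=; rewrite in_itv/= => yx.
rewrite /rayleigh_pdf (negPf s0) patchE ifF//; apply/negbTE/negP.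
by rewrite inE/= in_itv/= andbT leNgt (le_lt_trans yx).
Qed.

Lemma rayleigh_cdf_ge0 (x : R) : 0 <= x ->
  rayleigh_prob s `]-oo, x] = (1 - expR (- x ^+ 2 / (2 * s ^+ 2)))%:E.
Proof.
move=> x0; rewrite /rayleigh_prob /rayleigh_pdf (negPf s0).
rewrite -[X in integral _ _ X]/(EFin \o _) -restrict_EFin -integral_mkcondr.
have -> : `]-oo, x] `&` `[0, +oo[ = `[0, x]%classic.
  apply/seteqP; split => y /=; rewrite !in_itv/= andbT.
    by move=> [-> ->].
  by move=> /andP[-> ->].
move: x0; rewrite le_eqVlt => /predU1P[<-|x0].
  by rewrite set_itv1 integral_set1 expr0n/= oppr0 mul0r expR0 subrr.
rewrite (@continuous_FTC2 _ _ F)//.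
- by rewrite /F expr0n/= oppr0 mul0r expR0 -EFinB opprK addrC.
- exact/continuous_subspaceT/continuousf.
- split => [y _||].
  + by have [] := is_deriveF y.
  + exact/cvg_at_right_filter/continuousF.
  + exact/cvg_at_left_filter/continuousF.
- by move=> y _; rewrite derive1E; have [_ ->] := is_deriveF y.
Qed.

End RayleighCdf.

(** * The limit law *)

Section FactorialMoments.
Local Open Scope nat_scope.

Lemma ffact_le_exp x r : x ^_ r <= x ^ r.
Proof. by elim: r => //= r IH; rewrite ffactnSr expnSr leq_mul// leq_subr. Qed.

Lemma exp_le_ffact x r : x ^ r <= x ^_ r + r ^ 2 * x ^ r.-1.
Proof.
elim: r => [|r IH]; first by [].
rewrite expnSr ffactnSr; apply: (leq_trans (leq_mul IH (leqnn x))) => /=.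
have H1 : x ^_ r * x <= x ^_ r * (x - r) + r * x ^ r.
  apply: (@leq_trans (x ^_ r * ((x - r) + r))).
    by rewrite leq_mul2l; apply/orP; right; lia.
  by rewrite mulnDr leq_add2l mulnC leq_mul2l ffact_le_exp orbT.
have H2 : r ^ 2 * x ^ r.-1 * x = r ^ 2 * x ^ r.
  by case: r {IH H1} => [|r] //=; rewrite -mulnA -expnSr.
rewrite mulnDl H2; apply: (leq_trans (leq_add H1 (leqnn _))).
by rewrite -addnA leq_add2l -mulnDl leq_mul2r; apply/orP; right; lia.
Qed.

End FactorialMoments.

Section MomentConversion.
Variable R : realType.

(** Bounds the odd power left by the passage from falling factorials to powers in terms of the next
    even one, so no odd moment has to be controlled. *)
Let interpolation (x h : R) r : 0 <= x -> 0 < h -> x ^+ r <= h * x ^+ r.+1 + h^-1 ^+ r.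
Proof.
move=> x0 h0; have hi0 : 0 <= h^-1 by rewrite invr_ge0 ltW.
case: (leP 1 (h * x)) => hx.
  rewrite exprS mulrA; apply: (@le_trans _ _ (h * x * x ^+ r)).
    by rewrite ler_peMl// exprn_ge0.
  by rewrite lerDl exprn_ge0.
apply: (@le_trans _ _ (h^-1 ^+ r)).
  by rewrite lerXn2r ?nnegrE// -[h^-1]mul1r ler_pdivlMr// mulrC ltW.
by rewrite lerDr mulr_ge0 ?exprn_ge0// ltW.
Qed.

(** For positive [q] the power and the falling factorial differ by a multiple of the power [2q - 1].
    With [h = (n + 1)^(-1/2)] in [interpolation], that error is [O(h)] times one plus the moment. *)
Lemma cvg_moment_of_factorial (D : nat -> seq nat) q (l : R) :
  (\sum_(d <- D n) (d ^_ q.*2)%:R) / (size (D n))%:R / n.+1%:R ^+ q @[n --> \oo] --> l ->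
  (\sum_(d <- D n) d%:R ^+ q.*2) / (size (D n))%:R / n.+1%:R ^+ q @[n --> \oo] --> l.
Proof.
case: q => [|q] fl.
  rewrite (_ : (fun n => _) = (fun n =>
    (\sum_(d <- D n) (d ^_ 0.*2)%:R) / (size (D n))%:R / n.+1%:R ^+ 0))//.
set f := (fun n => _) in fl; set a := (fun n => _).
pose h n : R := Num.sqrt (harmonic n).
have h0 n : 0 < h n by rewrite sqrtr_gt0 /harmonic/= invr_gt0.
have hE n : h n ^+ 2 = n.+1%:R^-1 by rewrite sqr_sqrtr// /harmonic/= invr_ge0.
have hl : h n @[n --> \oo] --> (0 : R).
  rewrite -(sqrtr0 R); apply: continuous_cvg; first exact: sqrt_continuous.
  exact: cvg_harmonic.
pose r : R := q.+1.*2%:R ^+ 2.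
have rhl : r * h n @[n --> \oo] --> (0 : R).
  by rewrite -[X in _ --> X](mulr0 r); exact: cvgMr.
have fa n : f n <= a n.
  rewrite /f /a ler_wpM2r// ?invr_ge0 ?exprn_ge0// ler_wpM2r ?invr_ge0//.
  by apply: ler_sum => d _; rewrite -natrX ler_nat ffact_le_exp.
have af n : a n <= f n + r * h n * a n + r * h n.
  have size1 : (\sum_(d <- D n) (1 : R)) / (size (D n))%:R <= 1.
    rewrite big_const_seq count_predT iter_addr_0.
    by case: (size (D n)) => [|k]; rewrite ?mulr0n ?mul0r// divff// pnatr_eq0.
  have c0 : 0 <= (size (D n))%:R^-1 / n.+1%:R ^+ q.+1 :> R.
    by rewrite mulr_ge0 ?invr_ge0 ?exprn_ge0.
  have -> : f n + r * h n * a n + r * h n =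
      (\sum_(d <- D n) (d ^_ q.+1.*2)%:R + r * h n * \sum_(d <- D n) d%:R ^+ q.+1.*2) *
      ((size (D n))%:R^-1 / n.+1%:R ^+ q.+1) + r * h n.
    by rewrite /f /a; ring.
  apply: (@le_trans _ _ ((\sum_(d <- D n) (d ^_ q.+1.*2)%:R +
     r * h n * \sum_(d <- D n) d%:R ^+ q.+1.*2 +
     r * (h n)^-1 ^+ q.*2.+1 * \sum_(d <- D n) 1) *
      ((size (D n))%:R^-1 / n.+1%:R ^+ q.+1))).
    rewrite /a -mulrA; apply: ler_wpM2r => //.
    rewrite !mulr_sumr -!big_split/=; apply: ler_sum => d _.
    have := exp_le_ffact d q.+1.*2; rewrite -(ler_nat R) natrX natrD natrM 2!natrX /=.
    move=> /le_trans; apply; rewrite -addrA lerD2l mulr1 -/r -mulrA -mulrDr.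
    by apply: ler_wpM2l; [exact: sqr_ge0|exact: interpolation].
  rewrite mulrDl lerD2l.
  have -> : r * (h n)^-1 ^+ q.*2.+1 * (\sum_(d <- D n) 1) *
      ((size (D n))%:R^-1 / n.+1%:R ^+ q.+1) =
      r * h n * ((\sum_(d <- D n) (1 : R)) / (size (D n))%:R).
    rewrite -exprVn -hE -exprM mulnS add2n mul2n.
    rewrite [h n ^+ _.+2]exprS exprVn.
    move: ((size (D n))%:R^-1) => z.
    by field; rewrite expf_neq0// lt0r_neq0.
  by rewrite ler_piMr//; apply: mulr_ge0; [exact: sqr_ge0|exact: ltW].
(* The upper bound is [af] solved for [a n], possible once [r * h n < 1]. *)
apply: (@squeeze_cvgr _ _ _ _ f (fun n => (f n + r * h n) / (1 - r * h n))) => //.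
- have := cvgr_lt _ rhl _ (ltr01 : (0 : R) < 1); move=> rh1.
  near=> n; rewrite fa /= ler_pdivlMr; last by rewrite subr_gt0; near: n; exact: rh1.
  by rewrite mulrBr mulr1 lerBlDr mulrC; have := af n; lra.
- rewrite -[X in _ --> X]divr1 -[l in l / _]addr0 -[X in _ / X]subr0.
  apply: cvgM; first by apply: cvgD.
  apply: cvgV; first by rewrite subr0 oner_neq0.
  by apply: cvgB => //; exact: cvg_cst.
Unshelve. all: by end_near. Qed.

End MomentConversion.

Section Probability.
Variable R : realType.

Lemma counting_seq (T : choiceType) (t : seq T) : uniq t ->
  counting [set` t] = (size t)%:R%:E :> \bar R.
Proof.
move=> ut; rewrite /counting asboolT ?finite_seq//.
congr (_%:R%:E).
have -> : fset_set [set` t] = [fset x in t]%fset.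
  by apply/fsetP => x; rewrite in_fset_set ?finite_seq// !inE; apply/asboolP/idP.
by rewrite card_fseq undup_id.
Qed.

Lemma uniform_on_seq (A : set bargraph) (t : seq bargraph) (V : set bargraph) :
  uniq t -> (0 < size t)%N -> (forall B, B \in t <-> A B) ->
  uniform_on R A V = ((count (fun B => `[< V B >]) t)%:R / (size t)%:R)%:E.
Proof.
move=> ut t0 tA.
have AE : A = [set` t] by apply/seteqP; split => B /tA.
have E W : mrestr (@counting bargraph R) (measurable_bargraph A) W =
    (count (fun B => `[< W B >]) t)%:R%:E.
  rewrite /mrestr AE -size_filter -counting_seq ?filter_uniq//; congr counting.
  apply/seteqP; split => B /=; rewrite mem_filter.
    by move=> [WB ->]; rewrite andbT; apply/asboolP.
  by move=> /andP[/asboolP WB ->].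
have ET : mrestr (@counting bargraph R) (measurable_bargraph A) [set: bargraph] =
    (size t)%:R%:E.
  by rewrite E (eq_count (a2 := predT)) ?count_predT// => B; apply/asboolP.
pose m := mrestr (@counting bargraph R) (measurable_bargraph A).
have -> : uniform_on R A V = (if (m [set: bargraph] == 0%E) || (m [set: bargraph] == +oo%E)
    then fun U => \d_(point : bargraph) U
    else fun U => (m U * ((fine (m [set: bargraph]))^-1)%:E)%E) V by [].
by rewrite /m ET eqe pnatr_eq0 -leqn0 leqNgt t0/= E EFinM.
Qed.

End Probability.

Section LimitLaw.
Variable R : realType.
Let rho : R := (3 - Num.sqrt 5) / 2.
Let sigma : R := (3 - Num.sqrt 5) / (2 * 20 `^ 4^-1).
Let theta : R := 4 * rho ^+ 4 / ((1 - rho ^+ 2) * (1 + rho + rho ^+ 2)).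
Let t : R := Num.sqrt 5.

Let tE : t ^+ 2 = 5. Proof. by rewrite sqr_sqrtr. Qed.
Let t_bounds : 2 < t < 3.
Proof.
have t0 : 0 <= t := sqrtr_ge0 _.
by apply/andP; split; rewrite -(@ltr_pXn2r _ 2) ?nnegrE// tE; lra.
Qed.

Let rho01 : 0 < rho < 1.
Proof. by have /andP[] := t_bounds; rewrite /rho -/t; lra. Qed.

Let rhoE : rho ^+ 2 + 1 = 3 * rho.
Proof. by rewrite /rho -/t expr_div_n sqrrB tE; field. Qed.

Let theta_gt0 : 0 < theta.
Proof.
have /andP[r0 r1] := rho01.
have r2 : rho ^+ 2 < 1 by rewrite expr_lt1// ltW.
apply: divr_gt0; apply: mulr_gt0 => //; [exact: exprn_gt0|by rewrite subr_gt0|].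
by rewrite addr_gt0 ?exprn_gt0// addr_gt0.
Qed.

Let sigma_neq0 : sigma != 0.
Proof.
have /andP[_ t3] := t_bounds.
by rewrite gt_eqF// divr_gt0 ?subr_gt0// mulr_gt0// powR_gt0.
Qed.

(** From [1 + rho + rho^2 = 4 rho] and [1 - rho^2 = sqrt 5 * rho] both sides equal
    [rho^2 / sqrt 5]. *)
Let sigmaE : 2 * sigma ^+ 2 = theta.
Proof.
have p4 : (20 `^ 4^-1 : R) ^+ 2 = 2 * t.
  rewrite -powR_mulrn ?powR_ge0// -powRrM.
  have -> : 4^-1 * 2%:R = 2^-1 :> R by field.
  rewrite powR12_sqrt// /t (_ : 20 = 2 ^+ 2 * 5); last by ring.
  by rewrite sqrtrM ?sqr_ge0// sqrtr_sqr ger0_norm.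
have /andP[t2 t3] := t_bounds.
have /andP[r0 r1] := rho01.
have q1 : 1 + rho + rho ^+ 2 = 4 * rho by move: rhoE; lra.
have q2 : 1 - rho ^+ 2 = t * rho.
  by rewrite /rho -/t expr_div_n sqrrB mulrA mulrBr -expr2 tE; field.
rewrite /theta q1 q2 /sigma expr_div_n exprMn p4 -/t.
have -> : 3 - t = 2 * rho by rewrite /rho -/t; field.
by field; rewrite !lt0r_neq0//; apply: lt_trans t2.
Qed.

Let degrees N := [seq coincidences s | s <- all_pairs N].

Let sum_degrees N r : \sum_(d <- degrees N) (d ^_ r)%:R =
  r`!%:R * marked_series R r N.
Proof.
rewrite big_map -natr_sum sum_all_pairs /marked_series /fps_diag -natr_sum -natrM.
congr (_%:R); rewrite big_distrr/=; apply: eq_bigr => m _.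
rewrite /marked_pairs big_distrr/=; apply: eq_bigr => s _.
by rewrite mulnC bin_ffact.
Qed.

Let size_degrees N : (size (degrees N))%:R = whitney R 0 N.
Proof.
rewrite -marked_series0 -[RHS]mul1r -[1](_ : 0`!%:R = _)// -sum_degrees.
by rewrite big_const_seq count_predT iter_addr_0.
Qed.

Let cvg_factorial_moment q :
  (\sum_(d <- degrees n) (d ^_ q.*2)%:R) / (size (degrees n))%:R / n.+1%:R ^+ q
  @[n --> \oo] --> q`!%:R * theta ^+ q.
Proof.
rewrite -(cvg_shiftn (4 * q)).
rewrite (_ : [sequence _]_n = (fun n => (q.*2)`!%:R * (whitney R 0 ^+ q.*2.+1) n /
  whitney R 0 (n + 4 * q)%N / (n + 4 * q).+1%:R ^+ q)); first exact: cvg_whitney_moment.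
apply/funext => n /=; rewrite sum_degrees size_degrees marked_seriesE fpsXnM.
have -> : (q.*2.*2 = 4 * q)%N by lia.
by rewrite leq_addl addnK.
Qed.

Let scaled N : seq R := [seq d%:R ^+ 2 / (N.+1%:R * theta) | d <- degrees N].

Let cvg_scaled y : 0 <= y ->
  average (scaled n) (fun x => (x <= y)%R%:R) @[n --> \oo] --> 1 - expR (- y).
Proof.
apply: exponential_limit => [n x /mapP[d _ ->]|k].
  by rewrite divr_ge0// mulr_ge0// ltW.
rewrite (_ : (fun n => _) = (fun n => (\sum_(d <- degrees n) d%:R ^+ k.*2) /
    (size (degrees n))%:R / n.+1%:R ^+ k * theta ^- k)); last first.
  apply/funext => n; rewrite /average /scaled big_map size_map.
  rewrite (eq_bigr (fun d => d%:R ^+ k.*2 * (n.+1%:R ^- k * theta ^- k))).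
    by rewrite -mulr_suml; ring.
  by move=> d _; rewrite expr_div_n [(_ * theta) ^+ k]exprMn (invfM (n.+1%:R ^+ k)) -mul2n exprM.
have -> : k`!%:R = k`!%:R * theta ^+ k * theta ^- k :> R.
  by rewrite mulfK// expf_neq0// lt0r_neq0.
by apply: cvgMl; apply: cvg_moment_of_factorial; exact: cvg_factorial_moment.
Qed.

Let cdf_degsym N (x : R) : (0 < N)%N ->
  cdf ((Num.sqrt N.+1%:R)^-1 \o* degsym_rv R N.+1 :
    {RV (uniform_on R (unimodal_of_semiperimeter N.+1)) >-> R}) x =
  ((count (fun d : nat => d%:R / Num.sqrt N.+1%:R <= x) (degrees N))%:R /
   (size (degrees N))%:R)%:E.
Proof.
move=> N0; rewrite /cdf /distribution /pushforward.
rewrite (@uniform_on_seq _ _ (bargraphs_of_pairs N)); last 3 first.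
- exact: uniq_bargraphs_of_pairs.
- by rewrite -(size_map degree_of_symmetry) degrees_bargraphs_of_pairs.
- by move=> B; exact: mem_bargraphs_of_pairs.
rewrite -(size_map degree_of_symmetry) degrees_bargraphs_of_pairs// -/(degrees N).
congr (_%:R / _)%:E; rewrite /degrees -degrees_bargraphs_of_pairs// count_map.
by apply: eq_count => B /=; apply/asboolP/idP; rewrite /= in_itv.
Qed.

Lemma average_pred (s : seq R) (p : pred R) :
  average s (fun x => (p x)%:R) = (count p s)%:R / (size s)%:R.
Proof. by rewrite /average -natr_sum -big_mkcond sum1_count. Qed.

Lemma cvg_degsym_rayleigh : cvg_in_distribution
  (fun n => uniform_on R (unimodal_of_semiperimeter n))
  (fun n => (Num.sqrt n%:R)^-1 \o* degsym_rv R n)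
  (rayleigh_prob sigma).
Proof.
move=> /= x _.
(* Two terms are dropped so that the semiperimeter is [N.+1] with [N = n.+1] positive, as
   [cdf_degsym] requires. *)
rewrite -cvg_shiftS -cvg_shiftS.
rewrite (_ : [sequence _]_n = (fun n =>
  ((count (fun d : nat => d%:R / Num.sqrt n.+2%:R <= x) (degrees n.+1))%:R /
   (size (degrees n.+1))%:R)%:E)); last first.
  by apply/funext => n; exact: cdf_degsym.
case: (ltP x 0) => x0.
  rewrite rayleigh_cdf_lt0//.
  rewrite (_ : (fun n => _) = fun=> 0%E); first exact: cvg_cst.
  apply/funext => n; rewrite (_ : count _ _ = 0)%N ?mul0r//.
  apply/eqP; rewrite -leqn0 leqNgt -has_count; apply/hasPn => d _.
  by rewrite -ltNge (lt_le_trans x0)// divr_ge0// sqrtr_ge0.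
rewrite rayleigh_cdf_ge0// sigmaE mulNr.
apply: cvg_EFin; first by near=> n.
(* For [x >= 0] squaring turns the event into [V <= x^2 / theta], whose exponential limit is the
   Rayleigh distribution function by [sigmaE]. *)
have y0 : 0 <= x ^+ 2 / theta by rewrite divr_ge0 ?sqr_ge0// ltW.
have := cvg_scaled y0; rewrite -cvg_shiftS.
rewrite (_ : [sequence _]_n = (fun n =>
  (count (fun d : nat => d%:R / Num.sqrt n.+2%:R <= x) (degrees n.+1))%:R /
   (size (degrees n.+1))%:R))//.
apply/funext => n.
transitivity (average (scaled n.+1) (fun u => (u <= x ^+ 2 / theta)%R%:R)) => //.
rewrite average_pred /scaled size_map count_map.
congr (_%:R / _); apply: eq_count => d; rewrite [LHS]/=.
have n0 : 0 < n.+2%:R :> R by [].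
have d0 : 0 <= d%:R / Num.sqrt n.+2%:R :> R by rewrite divr_ge0// sqrtr_ge0.
rewrite invfM mulrA ler_pM2r ?invr_gt0// -[RHS](@ler_pXn2r _ 2) ?nnegrE//.
by rewrite expr_div_n sqr_sqrtr// ltW.
Unshelve. all: by end_near. Qed.

End LimitLaw.

Theorem proposition5p2 (R : realType) :
  cvg_in_distribution
    (fun n => uniform_on R (unimodal_of_semiperimeter n))
    (fun n => (Num.sqrt n%:R)^-1 \o* degsym_rv R n)
    (rayleigh_prob ((3 - Num.sqrt 5) / (2 * 20 `^ 4^-1))).
Proof. exact: cvg_degsym_rayleigh. Qed.
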